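(* Let $\phi:\Sigma^2\rightarrow \mathrm{Sol}_3$ be a surface of $\mathrm{Sol}_3$, with unit normal vector field $\xi$, shape operator $A$, mean curvature function $f=\frac12\operatorname{trace}A$ and Gaussian curvature $K$. Then $$ \begin{aligned} \tfrac{1}{2}\Delta|A|^2={}&|\nabla A|^2+2\operatorname{div}(A(\operatorname{grad} f))-4|\operatorname{grad} f|^2-4\langle\xi,E_3^{\perp}\rangle\langle\operatorname{grad} f,E_3^{\top}\rangle\\ &+2K(|A|^2-2f^2)+4\langle\xi,E_3^{\perp}\rangle^2(|A|^2-2f^2)\\ &-8f\langle\xi,E_3^{\perp}\rangle\left(\langle\xi,E_2^{\perp}\rangle^2-\langle\xi,E_1^{\perp}\rangle^2\right)+4f\langle AE_3^{\top},E_3^{\top}\rangle\\ &+4\langle\xi,E_3^{\perp}\rangle\langle AE_1^{\top},E_1^{\top}\rangle-4\langle\xi,E_3^{\perp}\rangle\langle AE_2^{\top},E_2^{\top}\rangle\\ &+4\langle\xi,E_1^{\perp}\rangle\langle AE_3^{\top},E_1^{\top}\rangle-4\langle\xi,E_2^{\perp}\rangle\langle AE_3^{\top},E_2^{\top}\rangle-4\langle AE_3^{\top},AE_3^{\top}\rangle . \end{aligned} $$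
   Context: $\mathrm{Sol}_3$ is $\mathbb{R}^3$ with coordinates $(x,y,z)$ and the Riemannian metric $\langle\cdot,\cdot\rangle=e^{2z}dx^2+e^{-2z}dy^2+dz^2$. Its canonical orthonormal frame is $E_1=e^{-z}\partial_x$, $E_2=e^{z}\partial_y$, $E_3=\partial_z$; $\bar\nabla$ is its Levi-Civita connection. A surface $\phi:\Sigma^2\to\mathrm{Sol}_3$ means a smooth isometric immersion of a connected Riemannian surface without boundary, equipped with a unit normal vector field $\xi$. For a vector field $X$ on $\mathrm{Sol}_3$, $X^{\top}$ and $X^{\perp}$ denote its tangent and normal parts along $\Sigma^2$ (so $\langle\xi,E_k^{\perp}\rangle=\langle\xi,E_k\rangle$). $\nabla$ is the induced Levi-Civita connection on $\Sigma^2$; the shape operator $A$ is defined by $AX=-\bar\nabla_X\xi$ for $X$ tangent; $f=\frac12\operatorname{trace}A$ is the mean curvature function; $K$ is the Gaussian curvature of the induced metric. $|A|^2=\operatorname{trace}(A^2)$, $|\nabla A|^2=\sum_{i,j}|(\nabla_{X_i}A)X_j|^2$ for a local orthonormal frame $\{X_1,X_2\}$ of $\Sigma^2$, and $\operatorname{grad}$, $\operatorname{div}$, $\Delta=\operatorname{div}\operatorname{grad}$ are taken on $\Sigma^2$ with the induced metric. *)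

(* Defs.v *)
(* MathComp-Analysis over an arbitrary R : realType. *)
From HB Require Import structures.
From mathcomp Require Export all_boot all_order all_algebra.
From mathcomp Require Export all_classical all_reals all_analysis.
Export Order.TTheory GRing.Theory Num.Theory.
Export numFieldNormedType.Exports.

Set Implicit Arguments.
Unset Strict Implicit.
Unset Printing Implicit Defensive.

Local Open Scope classical_set_scope.
Local Open Scope ring_scope.

(* Tangent vectors are row vectors in the coordinate basis and linear maps act
   on the right: d psi (X) = X *m 'J psi u, and an endomorphism with matrix A
   sends X to X *m A. *)

Definition ebase {R : realType} {n : nat} (i : 'I_n) : 'rV[R]_n :=
  delta_mx 0 i.

Fixpoint Ck_on {R : realType} {m : nat} {V : normedModType R} (k : nat)
    (U : set 'rV[R]_m) (f : 'rV[R]_m -> V) : Prop :=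
  if k is k'.+1 then
    (forall u, U u -> differentiable f u) /\
    (forall i : 'I_m, Ck_on k' U ('D_(ebase i) f))
  else forall u, U u -> {for u, continuous f}.

Definition smooth_on {R : realType} {m : nat} {V : normedModType R}
    (U : set 'rV[R]_m) (f : 'rV[R]_m -> V) : Prop :=
  forall k, Ck_on k U f.

(** * Riemannian geometry in coordinates *)

Definition inner {R : realType} {n : nat} (g : 'M[R]_n) (v w : 'rV[R]_n) : R :=
  (v *m g *m w^T) 0 0.

Definition christoffel {R : realType} {n : nat} (g : 'rV[R]_n -> 'M[R]_n)
    (k i j : 'I_n) (u : 'rV[R]_n) : R :=
  2^-1 * \sum_l invmx (g u) k l *
    ('D_(ebase i) (fun v => g v j l) u + 'D_(ebase j) (fun v => g v i l) u
     - 'D_(ebase l) (fun v => g v i j) u).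

Definition nabla {R : realType} {n : nat} (g : 'rV[R]_n -> 'M[R]_n)
    (X Y : 'rV[R]_n -> 'rV[R]_n) (u : 'rV[R]_n) : 'rV[R]_n :=
  'D_(X u) Y u
  + \row_k \sum_i \sum_j christoffel g k i j u * X u 0 i * Y u 0 j.

(* Derivative, in the direction of the tangent vector X at u, of a field V
   along psi, for the Levi-Civita connection of the metric G of the target. *)
Definition nabla_along {R : realType} {m n : nat} (G : 'rV[R]_n -> 'M[R]_n)
    (psi V : 'rV[R]_m -> 'rV[R]_n) (X u : 'rV[R]_m) : 'rV[R]_n :=
  'D_X V u
  + \row_k \sum_a \sum_b
      christoffel G k a b (psi u) * (X *m 'J psi u) 0 a * V u 0 b.

Definition lie_bracket {R : realType} {n : nat}
    (X Y : 'rV[R]_n -> 'rV[R]_n) (u : 'rV[R]_n) : 'rV[R]_n :=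
  'D_(X u) Y u - 'D_(Y u) X u.

Definition curvature {R : realType} {n : nat} (g : 'rV[R]_n -> 'M[R]_n)
    (X Y Z : 'rV[R]_n -> 'rV[R]_n) (u : 'rV[R]_n) : 'rV[R]_n :=
  nabla g X (nabla g Y Z) u - nabla g Y (nabla g X Z) u
  - nabla g (lie_bracket X Y) Z u.

Definition gauss_curvature {R : realType} (g : 'rV[R]_2 -> 'M[R]_2)
    (u : 'rV[R]_2) : R :=
  let X := ebase 0 in let Y := ebase 1 in
  inner (g u) (curvature g (cst X) (cst Y) (cst Y) u) X
  / (inner (g u) X X * inner (g u) Y Y - inner (g u) X Y ^+ 2).

Definition grad {R : realType} {n : nat} (g : 'rV[R]_n -> 'M[R]_n)
    (h : 'rV[R]_n -> R) (u : 'rV[R]_n) : 'rV[R]_n :=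
  (\row_j 'D_(ebase j) h u) *m invmx (g u).

(* The trace of X |-> nabla_X Y. *)
Definition divergence {R : realType} {n : nat} (g : 'rV[R]_n -> 'M[R]_n)
    (Y : 'rV[R]_n -> 'rV[R]_n) (u : 'rV[R]_n) : R :=
  \sum_i nabla g (cst (ebase i)) Y u 0 i.

Definition laplacian {R : realType} {n : nat} (g : 'rV[R]_n -> 'M[R]_n)
    (h : 'rV[R]_n -> R) : 'rV[R]_n -> R :=
  divergence g (grad g h).

Definition endo_app {R : realType} {n : nat} (A : 'rV[R]_n -> 'M[R]_n)
    (X : 'rV[R]_n -> 'rV[R]_n) (u : 'rV[R]_n) : 'rV[R]_n :=
  X u *m A u.

(* (nabla_X A) Y *)
Definition nabla_endo {R : realType} {n : nat} (g A : 'rV[R]_n -> 'M[R]_n)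
    (X Y : 'rV[R]_n -> 'rV[R]_n) (u : 'rV[R]_n) : 'rV[R]_n :=
  nabla g X (endo_app A Y) u - endo_app A (nabla g X Y) u.

Definition orthonormal_frame_on {R : realType} {n : nat}
    (g : 'rV[R]_n -> 'M[R]_n) (U : set 'rV[R]_n)
    (F : 'I_n -> 'rV[R]_n -> 'rV[R]_n) : Prop :=
  (forall i, smooth_on U (F i)) /\
  (forall u, U u -> forall i j, inner (g u) (F i u) (F j u) = (i == j)%:R).

Definition nabla_endo_sqnorm {R : realType} {n : nat}
    (g A : 'rV[R]_n -> 'M[R]_n) (F : 'I_n -> 'rV[R]_n -> 'rV[R]_n)
    (u : 'rV[R]_n) : R :=
  \sum_i \sum_j inner (g u) (nabla_endo g A (F i) (F j) u)
                            (nabla_endo g A (F i) (F j) u).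

(** * Smooth and Riemannian surfaces *)

Record chart {R : realType} (M : topologicalType) := Chart {
  chart_dom : set M;
  chart_coord : M -> 'rV[R]_2;
  chart_param : 'rV[R]_2 -> M }.

Definition chart_cod {R : realType} {M : topologicalType}
    (c : @chart R M) : set 'rV[R]_2 :=
  chart_coord c @` chart_dom c.

Definition is_chart {R : realType} {M : topologicalType}
    (c : @chart R M) : Prop :=
  [/\ open (chart_dom c) /\ open (chart_cod c),
      forall p, chart_dom c p -> chart_param c (chart_coord c p) = p,
      {within chart_dom c, continuous (chart_coord c)} &
      {within chart_cod c, continuous (chart_param c)}].

Definition transition {R : realType} {M : topologicalType}
    (c c' : @chart R M) : 'rV[R]_2 -> 'rV[R]_2 :=
  chart_coord c' \o chart_param c.

Definition overlap {R : realType} {M : topologicalType}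
    (c c' : @chart R M) : set 'rV[R]_2 :=
  chart_coord c @` (chart_dom c `&` chart_dom c').

Record smooth_surface (R : realType) := SmoothSurface {
  surface_space :> topologicalType;
  surface_hausdorff : hausdorff_space surface_space;
  surface_second_countable : @second_countable surface_space;
  surface_connected : connected [set: surface_space];
  atlas : set (@chart R surface_space);
  atlas_chart : forall c, atlas c -> is_chart c;
  atlas_cover : forall p, exists2 c, atlas c & chart_dom c p;
  atlas_compatible : forall c c', atlas c -> atlas c' ->
    smooth_on (overlap c c') (transition c c') }.

Record riemannian_surface (R : realType) := RiemannianSurface {
  riem_surface :> smooth_surface R;
  metric : @chart R riem_surface -> 'rV[R]_2 -> 'M[R]_2;
  metric_smooth : forall c, atlas c -> smooth_on (chart_cod c) (metric c);
  metric_sym : forall c u, atlas c -> chart_cod c u ->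
    (metric c u)^T = metric c u;
  metric_pos : forall c u, atlas c -> chart_cod c u ->
    forall v : 'rV[R]_2, v != 0 -> 0 < inner (metric c u) v v;
  metric_compatible : forall c c' u, atlas c -> atlas c' -> overlap c c' u ->
    metric c u = 'J (transition c c') u
                 *m metric c' (transition c c' u)
                 *m ('J (transition c c') u)^T }.

(** * The ambient space Sol_3 and its surfaces *)

(* Points of Sol_3 are rows (x, y, z); thus z is the entry of index 2. *)
Definition sol_metric {R : realType} (q : 'rV[R]_3) : 'M[R]_3 :=
  diag_mx (\row_k [:: expR (2 * q 0 2); expR (- (2 * q 0 2)); 1]`_k).

Definition E1 {R : realType} (q : 'rV[R]_3) : 'rV[R]_3 :=
  expR (- q 0 2) *: ebase 0.
Definition E2 {R : realType} (q : 'rV[R]_3) : 'rV[R]_3 :=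
  expR (q 0 2) *: ebase 1.
Definition E3 {R : realType} (q : 'rV[R]_3) : 'rV[R]_3 :=
  ebase 2.

Definition isometric_immersion {R : realType} (S : riemannian_surface R)
    (phi : S -> 'rV[R]_3) : Prop :=
  forall c : @chart R S, atlas c ->
    let psi := phi \o chart_param c in
    smooth_on (chart_cod c) psi /\
    forall u, chart_cod c u ->
      row_free ('J psi u) /\
      metric c u = 'J psi u *m sol_metric (psi u) *m ('J psi u)^T.

Definition unit_normal_field {R : realType} (S : riemannian_surface R)
    (phi xi : S -> 'rV[R]_3) : Prop :=
  forall c : @chart R S, atlas c ->
    let psi := phi \o chart_param c in
    let nu := xi \o chart_param c in
    smooth_on (chart_cod c) nu /\
    forall u, chart_cod c u ->
      inner (sol_metric (psi u)) (nu u) (nu u) = 1 /\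
      forall X : 'rV[R]_2,
        inner (sol_metric (psi u)) (nu u) (X *m 'J psi u) = 0.

(* The coordinates, in the basis of the coordinate fields of the surface, of
   the orthogonal projection of V onto the tangent plane. *)
Definition tangent_part {R : realType} (g : 'rV[R]_2 -> 'M[R]_2)
    (psi : 'rV[R]_2 -> 'rV[R]_3) (V : 'rV[R]_3) (u : 'rV[R]_2) : 'rV[R]_2 :=
  V *m sol_metric (psi u) *m ('J psi u)^T *m invmx (g u).

Definition normal_part {R : realType} (g : 'rV[R]_2 -> 'M[R]_2)
    (psi : 'rV[R]_2 -> 'rV[R]_3) (V : 'rV[R]_3) (u : 'rV[R]_2) : 'rV[R]_3 :=
  V - tangent_part g psi V u *m 'J psi u.

(* As nu has unit length its covariant derivatives are already tangent, so
   tangent_part only expresses - nabla_X nu in the coordinate basis. *)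
Definition shape_operator {R : realType} (g : 'rV[R]_2 -> 'M[R]_2)
    (psi nu : 'rV[R]_2 -> 'rV[R]_3) (u : 'rV[R]_2) : 'M[R]_2 :=
  \matrix_i tangent_part g psi
              (- nabla_along sol_metric psi nu (ebase i) u) u.

Definition mean_curvature {R : realType} (A : 'rV[R]_2 -> 'M[R]_2)
    (u : 'rV[R]_2) : R :=
  2^-1 * \tr (A u).

Definition shape_sqnorm {R : realType} (A : 'rV[R]_2 -> 'M[R]_2)
    (u : 'rV[R]_2) : R :=
  \tr (A u *m A u).

(* Main.v *)
(* Everything is computed in the given orthonormal frame F0, F1 of the surface.
   Its connection form w is read off the bracket [F0, F1], so the tangential part
   of the Gauss formula for the immersion involves the same w as the intrinsic
   connection.  In the orthonormal frame (E1, E2, E3) of Sol_3 the Christoffel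
   symbols are constant, which turns the Gauss and Weingarten formulas into
   equations for the derivatives of the coordinates of F0, F1 and the normal xi;
   applying the commutator [F0, F1] to the coordinates of xi gives
   (nabla_X A) Y - (nabla_Y A) X = 2 <xi, E3> (<Y, E3> X - <X, E3> Y).
   Applied to the components of A the same commutator brings in the Gaussian
   curvature, and with the differentiated Codazzi equation the Simons-type
   identity becomes a polynomial identity modulo the orthogonality of the matrix
   of coordinates. *)

(* Neither the curvature tensor of [Sol_3] nor the Gauss equation is ever computed. K enters only as
   the curvature of the connection form, which is exactly the quantity that the commutator of F0, F1
   leaves on the components of A, so the term in K survives unexpanded. The terms that contain E1,
   E2, E3 all come from the right side of the Codazzi equation: its trace gives the term in grad f
   (through div A), its derivatives give the others. The obstacle is that all functions are total
   while the equations hold only on U. An equation that is to be differentiated is therefore stated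
   at every point of the open set U and carried through derivatives by [open_derive_eq]; the algebra
   is then done on plain real numbers, where [ring] sees few atoms. *)
Require Import Defs.
From mathcomp Require Import ring lra.
Local Open Scope classical_set_scope.
Local Open Scope ring_scope.
Set Implicit Arguments.
Unset Strict Implicit.
Unset Printing Implicit Defensive.

(** * Smooth functions *)

Section smooth_calculus.
Context {R : realType} {m : nat}.
Implicit Types (U : set 'rV[R]_m) (V : normedModType R).

(** The little-o expansion at x only concerns nearby points, so the differential of f also serves
    for g. *)
Lemma near_eq_differentiable V (f g : 'rV[R]_m -> V) (x : 'rV[R]_m) :
  (\near x, f x = g x) -> differentiable f x -> differentiable g x.
Proof.
move=> fg df; have [dc /eqaddoP fo] := (diff_locallyP _ _).1 df.
have go : g \o shift x = cst (g x) + ('d f x : 'rV[R]_m -> V) +o_ (0 : 'rV[R]_m) id.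
  have fg0 : \forall h \near (0 : 'rV[R]_m), f (h + x) = g (h + x).
    by move: fg; rewrite (near_shift 0 x) /= subr0.
  apply/eqaddoP => e e0; move: (fo e e0); apply: filterS2 fg0 => h fgh.
  suff -> : (f \o shift x - (cst (f x) + ('d f x : 'rV[R]_m -> V))) h =
            (g \o shift x - (cst (g x) + ('d f x : 'rV[R]_m -> V))) h by [].
  by rewrite /GRing.add /GRing.opp /= fgh (nbhs_singleton fg).
by apply/diff_locallyP; rewrite (diff_unique dc go); split.
Qed.

Lemma open_near U (u : 'rV[R]_m) (P : 'rV[R]_m -> Prop) : open U -> U u ->
  (forall v, U v -> P v) -> \forall v \near u, P v.
Proof. by move=> oU Uu H; apply: filterS H _; exact: open_nbhs_nbhs. Qed.

Lemma open_derive_eq V U (f g : 'rV[R]_m -> V) u x : open U -> U u ->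
  (forall v, U v -> f v = g v) -> 'D_x f u = 'D_x g u.
Proof. by move=> oU Uu fg; apply: near_eq_derive; exact: open_near fg. Qed.

(** The functions may differ off U. Openness makes their partial derivatives agree on U again, which
    lets the induction on k continue. *)
Lemma Ck_on_eq V k U (f g : 'rV[R]_m -> V) : open U ->
  (forall u, U u -> f u = g u) -> Ck_on k U f -> Ck_on k U g.
Proof.
move=> oU; elim: k f g => [|k IH] f g fg /=.
  move=> cf u Uu.
  have nfg : \forall v \near u, f v = g v by exact: open_near fg.
  rewrite /prop_for /continuous_at -(fg _ Uu).
  by apply: cvg_trans (cf u Uu); exact: (near_eq_cvg nfg).
move=> [df Cf]; split=> [u Uu|i].
  by apply: near_eq_differentiable (df u Uu); exact: open_near fg.
by apply: IH (Cf i) => u Uu; apply: open_derive_eq fg.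
Qed.

Lemma Ck_on_sub V k U U' (f : 'rV[R]_m -> V) :
  U `<=` U' -> Ck_on k U' f -> Ck_on k U f.
Proof.
move=> UU'; elim: k f => [|k IH] f /= => [H u /UU'|[df Cf]]; first exact: H.
by split=> [u /UU'|i]; [exact: df|exact: IH].
Qed.

Lemma Ck_onS V k U (f : 'rV[R]_m -> V) : Ck_on k.+1 U f -> Ck_on k U f.
Proof.
elim: k f => [|k IH] f [df Cf].
  by move=> u Uu; apply: differentiable_continuous; exact: df.
by split=> // i; apply: IH; exact: Cf.
Qed.

Lemma smooth_on_eq V U (f g : 'rV[R]_m -> V) : open U ->
  (forall u, U u -> f u = g u) -> smooth_on U f -> smooth_on U g.
Proof. by move=> oU fg sf k; exact: Ck_on_eq (sf k). Qed.

Lemma smooth_on_sub V U U' (f : 'rV[R]_m -> V) :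
  U `<=` U' -> smooth_on U' f -> smooth_on U f.
Proof. by move=> UU' sf k; exact: Ck_on_sub (sf k). Qed.

Lemma smooth_differentiable V U (f : 'rV[R]_m -> V) u :
  smooth_on U f -> U u -> differentiable f u.
Proof. by move=> /(_ 1)[df _]; exact: df. Qed.

Lemma smooth_is_derive V U (f : 'rV[R]_m -> V) u x :
  smooth_on U f -> U u -> is_derive u x f ('D_x f u).
Proof. by move=> sf Uu; apply/derivableP/diff_derivable/smooth_differentiable. Qed.

Lemma smooth_partial V U (f : 'rV[R]_m -> V) i :
  smooth_on U f -> smooth_on U ('D_(ebase i) f).
Proof. by move=> sf k; have [_] := sf k.+1; exact. Qed.

Lemma derive_coord n p (f : 'rV[R]_m -> 'M[R]_(n, p)) i j u x :
  differentiable f u -> 'D_x (fun v => f v i j) u = ('D_x f u) i j.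
Proof. by move=> df; rewrite derive_mx ?mxE //; exact: diff_derivable. Qed.

Lemma smooth_coord n p U (f : 'rV[R]_m -> 'M[R]_(n, p)) i j :
  open U -> smooth_on U f -> smooth_on U (fun u => f u i j).
Proof.
move=> oU sf k; elim: k f sf => [|k IH] f sf /=.
  move=> u Uu; apply: differentiable_continuous.
  apply: (@differentiable_comp _ _ _ _ f (fun M : 'M[R]_(n,p) => M i j)).
    exact: smooth_differentiable sf Uu.
  exact: differentiable_coord.
split=> [u Uu|l].
  apply: (@differentiable_comp _ _ _ _ f (fun M : 'M[R]_(n,p) => M i j)).
    exact: smooth_differentiable sf Uu.
  exact: differentiable_coord.
apply: Ck_on_eq (IH _ (smooth_partial l sf)) => // u Uu.
by rewrite derive_coord //; exact: smooth_differentiable sf Uu.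
Qed.

Lemma differentiable_mx n p (f : 'rV[R]_m -> 'M[R]_(n, p)) u :
  (forall i j, differentiable (fun v => f v i j) u) -> differentiable f u.
Proof.
move=> df.
have -> : f = \sum_(i < n) \sum_(j < p) (fun v => f v i j *: delta_mx i j).
  apply/funext => v; rewrite {1}[f v]matrix_sum_delta.
  rewrite fct_sumE; apply: eq_bigr => i _; rewrite fct_sumE; apply: eq_bigr => j _ //.
apply: differentiable_sum => i; apply: differentiable_sum => j.
exact: differentiableZl.
Qed.

Implicit Types f g : 'rV[R]_m -> R.

(** The differentiation rules are restated with an explicit [fun v] and the ring operations of R,
    the shape on which [derive_rules] matches. *)
Lemma is_derive_add f g u x (a b : R) : is_derive u x f a -> is_derive u x g b ->
  is_derive u x (fun v => f v + g v) (a + b).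
Proof. exact: is_deriveD. Qed.

Lemma is_derive_opp f u x (a : R) : is_derive u x f a ->
  is_derive u x (fun v => - f v) (- a).
Proof. exact: is_deriveN. Qed.

Lemma is_derive_mul f g u x (a b : R) : is_derive u x f a -> is_derive u x g b ->
  is_derive u x (fun v => f v * g v) (f u * b + a * g u).
Proof. by move=> fa gb; rewrite [a * _]mulrC; exact: is_deriveM. Qed.

Lemma is_derive_scale (c : R) f u x (a : R) : is_derive u x f a ->
  is_derive u x (fun v => c * f v) (c * a).
Proof. exact: is_deriveZ. Qed.

Lemma is_derive_const (r : R) (u x : 'rV[R]_m) : is_derive u x (fun=> r) 0.
Proof. exact: is_derive_cst. Qed.

Lemma is_derive_exp f u x : differentiable f u ->
  is_derive u x (fun v => expR (f v)) (expR (f u) * 'D_x f u).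
Proof.
move=> df.
have de : differentiable (@expR R) (f u).
  by apply/derivable1_diffP; exact: derivable_expR.
have dc : differentiable (expR \o f) u by exact: differentiable_comp.
apply: DeriveDef; first exact: (@diff_derivable _ _ _ (expR \o f)).
rewrite (@deriveE _ _ _ (expR \o f)) // diff_comp //=.
(* The real number 'D_x f u is read as a multiple of the vector 1, so that linearity pulls it out of
   the outer differential. *)
have -> : 'd f u x = 'D_x f u *: (1 : R) by rewrite deriveE // [RHS]mulr1.
by rewrite linearZ /= -deriveE // (@derive_val _ _ _ _ _ _ _ (is_derive_expR (f u))) [LHS]mulrC.
Qed.

Lemma is_derive_uniq U f g u x (a b : R) : open U -> U u ->
  (forall v, U v -> f v = g v) ->
  is_derive u x f a -> is_derive u x g b -> a = b.
Proof.
move=> oU Uu fg fa gb.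
by rewrite -(@derive_val _ _ _ _ _ _ _ fa) -(@derive_val _ _ _ _ _ _ _ gb); exact: open_derive_eq fg.
Qed.

Lemma smooth_const U (r : R) : smooth_on U (fun=> r).
Proof.
move=> k; elim: k r => [|k IH] r /=; first by move=> u _; exact: cst_continuous.
split=> [u _|i]; first exact: differentiable_cst.
rewrite [X in Ck_on k U X](_ : _ = fun=> 0) //.
by apply/funext => u; exact: derive_cst.
Qed.

Lemma Ck_on_add k U f g : open U -> Ck_on k U f -> Ck_on k U g ->
  Ck_on k U (fun u => f u + g u).
Proof.
move=> oU; elim: k f g => [|k IH] f g /=.
  by move=> sf sg u Uu; apply: (@continuousD _ _ _ f g); auto.
move=> [df sf] [dg sg].
split=> [u Uu|i]; first by apply: (@differentiableD _ _ _ f g); auto.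
apply: Ck_on_eq (IH _ _ (sf i) (sg i)) => // u Uu.
by rewrite (@deriveD _ _ _ f g) //; apply: diff_derivable; auto.
Qed.

Lemma smooth_add U f g : open U -> smooth_on U f -> smooth_on U g ->
  smooth_on U (fun u => f u + g u).
Proof. by move=> oU sf sg k; exact: Ck_on_add. Qed.

Lemma Ck_on_mul k U f g : open U -> Ck_on k U f -> Ck_on k U g ->
  Ck_on k U (fun u => f u * g u).
Proof.
move=> oU.
elim: k f g => [|k IH] f g /=.
  by move=> sf sg u Uu; apply: (@continuousM _ _ f g); auto.
move=> sf sg; have [df cf] := sf; have [dg cg] := sg.
split=> [u Uu|i]; first by apply: (@differentiableM _ _ f g); auto.
(* Each term of the product rule keeps one undifferentiated factor, which [Ck_onS] lowers to the
   class of the other. *)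
have := Ck_on_add oU (IH _ _ (Ck_onS sf) (cg i)) (IH _ _ (cf i) (Ck_onS sg)).
apply: Ck_on_eq => // u Uu; rewrite (@deriveM _ _ f g) //; try by apply: diff_derivable; auto.
by congr (_ + _); rewrite mulrC.
Qed.

Lemma smooth_mul U f g : open U -> smooth_on U f -> smooth_on U g ->
  smooth_on U (fun u => f u * g u).
Proof. by move=> oU sf sg k; exact: Ck_on_mul. Qed.

Lemma smooth_opp U f : open U -> smooth_on U f -> smooth_on U (fun u => - f u).
Proof.
move=> oU sf; have := smooth_mul oU (smooth_const U (-1)) sf.
by apply: smooth_on_eq => // u _; rewrite mulN1r.
Qed.

(** The partials of exp f are exp f times those of f, so the induction on k is about one fixed
    function. *)
Lemma smooth_exp U f : open U -> smooth_on U f -> smooth_on U (fun u => expR (f u)).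
Proof.
move=> oU sf k; have df := @smooth_differentiable _ _ f _ sf.
elim: k => [|k IH] /=.
  move=> u Uu; apply: (@continuous_comp _ _ _ f expR); first exact: (sf 0).
  exact: continuous_expR.
split=> [u Uu|i].
  apply: (@differentiable_comp _ _ _ _ f expR); first exact: df.
  by apply/derivable1_diffP; exact: derivable_expR.
have := Ck_on_mul oU IH (smooth_partial i sf k).
apply: Ck_on_eq => // u Uu.
by rewrite (@derive_val _ _ _ _ _ _ _ (is_derive_exp _ (df u Uu))).
Qed.

Lemma smooth_sum (I : Type) (r : seq I) U (f : I -> 'rV[R]_m -> R) : open U ->
  (forall i, smooth_on U (f i)) -> smooth_on U (fun u => \sum_(i <- r) f i u).
Proof.
move=> oU sf; elim: r => [|i r IH].
  by apply: smooth_on_eq (smooth_const U 0) => // u _; rewrite big_nil.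
by apply: smooth_on_eq (smooth_add oU (sf i) IH) => // u _; rewrite big_cons.
Qed.

End smooth_calculus.

(** * Symmetry of second partial derivatives *)

Section schwarz.
Context {R : realType} {m : nat}.
Implicit Types (f : 'rV[R]_m -> R) (u e p : 'rV[R]_m).

(** The difference quotients of t |-> f (t e + p) are literally those of f in the direction e, so no
    chain rule is involved. *)
Lemma is_derive_line f e p (s : R) : differentiable f (s *: e + p) ->
  is_derive s 1 (fun t => f (t *: e + p)) ('D_e f (s *: e + p)).
Proof.
move=> df.
have E : (fun h : R => h^-1 *: (f ((h *: 1 + s) *: e + p) - f (s *: e + p))) =
         (fun h : R => h^-1 *: (f (h *: e + (s *: e + p)) - f (s *: e + p))).
  by apply/funext => h; rewrite [h *: 1]mulr1 scalerDl addrA.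
apply: DeriveDef; last by rewrite /derive /= E.
by rewrite /derivable /= E; exact: diff_derivable.
Qed.

Lemma MVT_line f e p (r : R) : 0 < r ->
  (forall s, 0 <= s <= r -> differentiable f (s *: e + p)) ->
  exists2 c, 0 <= c <= r & f (r *: e + p) - f p = 'D_e f (c *: e + p) * r.
Proof.
move=> r0 df.
have dl s : s \in `]0, r[%R ->
    is_derive s 1 (fun t => f (t *: e + p)) ('D_e f (s *: e + p)).
  rewrite in_itv /= => /andP[s0 sr]; apply: is_derive_line.
  by apply: df; rewrite !ltW.
have [|c] := MVT r0 dl.
  apply: derivable_within_continuous => s; rewrite in_itv /= => s0r.
  by apply: ex_derive; apply: is_derive_line; apply: df.
rewrite in_itv /= => /andP[c0 cr]; rewrite scale0r add0r subr0 => E.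
by exists c => //; rewrite !ltW.
Qed.

(* The mean value theorem, applied once in each direction. *)
Lemma second_difference f u e e' (r : R) : 0 < r ->
  (forall s t, 0 <= s <= r -> 0 <= t <= r ->
    differentiable f (s *: e + (t *: e' + u)) /\
    differentiable ('D_e f) (s *: e + (t *: e' + u))) ->
  exists s t, [/\ 0 <= s <= r, 0 <= t <= r &
    f (r *: e + (r *: e' + u)) - f (r *: e' + u) - (f (r *: e + u) - f u)
    = 'D_e' ('D_e f) (s *: e + (t *: e' + u)) * r * r].
Proof.
move=> r0 df.
have rr : 0 <= r <= r by rewrite lexx ltW.
have r00 : 0 <= (0 : R) <= r by rewrite lexx ltW.
pose k v := f (v + r *: e') - f v.
have shiftk v : 'D_e (fun v => f (v + r *: e')) v = 'D_e f (v + r *: e').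
  have E : (fun h : R => h^-1 *: (f (h *: e + v + r *: e') - f (v + r *: e'))) =
           (fun h : R => h^-1 *: (f (h *: e + (v + r *: e')) - f (v + r *: e'))).
    by apply/funext => h; rewrite addrA.
  by rewrite /derive /= E.
have dk s : 0 <= s <= r -> differentiable (fun v => f (v + r *: e')) (s *: e + u).
  move=> sr; apply: (@differentiable_comp _ _ _ _ (fun v => v + r *: e') f).
    exact: differentiableD.
  by rewrite -addrA [u + _]addrC; apply: (df s r _ _).1.
have df0 s : 0 <= s <= r -> differentiable f (s *: e + u).
  by move=> sr; have := (df s 0 sr r00).1; rewrite scale0r add0r.
have [s sr Es] : exists2 c, 0 <= c <= r &
    k (r *: e + u) - k u = 'D_e k (c *: e + u) * r.
  apply: (@MVT_line k e u r r0) => s sr.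
  by apply: (@differentiableB _ _ _ (fun v => f (v + r *: e')) f); auto.
have [t tr Et] : exists2 c, 0 <= c <= r &
    'D_e f (r *: e' + (s *: e + u)) - 'D_e f (s *: e + u)
    = 'D_e' ('D_e f) (c *: e' + (s *: e + u)) * r.
  apply: (@MVT_line ('D_e f) e' (s *: e + u) r r0) => t tr; rewrite addrCA; exact: (df s t sr tr).2.
exists s, t; split => //.
rewrite [_ *: e + (t *: e' + u)]addrCA -Et.
have -> : 'D_e f (r *: e' + (s *: e + u)) - 'D_e f (s *: e + u) = 'D_e k (s *: e + u).
  rewrite (@deriveB _ _ _ (fun v => f (v + r *: e')) f).
  - by rewrite shiftk [r *: e' + _]addrC.
  - by apply: diff_derivable; auto.
  - by apply: diff_derivable; auto.
rewrite -Es /k -!addrA [u + r *: e']addrC; ring.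
Qed.

(** The second difference of f over a small parallelogram is symmetric in the two directions. By
    [second_difference] the two mixed derivatives thus take a common value, each at some point near
    u; continuity at u, with half the supposed gap as tolerance, gives the contradiction. *)
Lemma schwarz U f u i j : open U -> smooth_on U f -> U u ->
  'D_(ebase i) ('D_(ebase j) f) u = 'D_(ebase j) ('D_(ebase i) f) u.
Proof.
move=> oU sf Uu; set e := ebase i; set e' := ebase j.
have se := smooth_partial i sf; have se' := smooth_partial j sf.
apply/eqP; rewrite -subr_eq0 -normr_eq0; apply/negPn/negP => ne0.
pose d := `|'D_e ('D_e' f) u - 'D_e' ('D_e f) u|.
have d0 : 0 < d / 2 by rewrite divr_gt0 // lt0r ne0 normr_ge0.
have key (X Y : 'rV[R]_m -> R) : {for u, continuous X} -> {for u, continuous Y} ->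
    exists2 rho : R, 0 < rho & forall v, ball u rho v ->
      [/\ U v, `|X u - X v| < d / 2 & `|Y u - Y v| < d / 2].
  move=> /cvgrPdist_lt /(_ _ d0) cX /cvgrPdist_lt /(_ _ d0) cY.
  have nU : nbhs u U by exact: open_nbhs_nbhs.
  have H : \forall v \near u, [/\ U v, `|X u - X v| < d / 2 & `|Y u - Y v| < d / 2].
    by apply: filterS3 nU cX cY.
  by have /nbhs_ballP [rho rho0 Hr] := H; exists rho.
have [rho rho0 Hr] := key _ _ (smooth_partial j se 0 u Uu) (smooth_partial i se' 0 u Uu).
(* With this side length r the whole parallelogram lies in the ball of radius rho; the summand 1
   keeps N positive and the inclusion strict. *)
pose N := `|e| + `|e'| + 1; pose r := rho / N.
have N0 : 0 < N by rewrite ltr_wpDl.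
have r0 : 0 < r by rewrite divr_gt0.
have inb x y s t : `|x| + `|y| + 1 = N -> 0 <= s <= r -> 0 <= t <= r ->
    ball u rho (s *: x + (t *: y + u)).
  move=> xyN /andP[s0 sr] /andP[t0 tr].
  rewrite -ball_normE /= addrA opprD addrCA subrr addr0 normrN.
  apply: le_lt_trans (ler_normD _ _) _; rewrite !normrZ !ger0_norm //.
  apply: (@le_lt_trans _ _ (r * (`|x| + `|y|))).
    by rewrite mulrDr lerD // ler_wpM2r.
  by rewrite /r -mulrA gtr_pMr // mulrC ltr_pdivrMr // mul1r -xyN ltrDl.
have N1 : `|e| + `|e'| + 1 = N by [].
have N2 : `|e'| + `|e| + 1 = N by rewrite [`|e'| + _]addrC.
have [|s [t [sr tr E1]]] := @second_difference f u e e' r r0.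
  move=> s t sr tr; have [Uv _ _] := Hr _ (inb _ _ _ _ N1 sr tr).
  by split; [exact: smooth_differentiable sf Uv|exact: smooth_differentiable se Uv].
have [|s' [t' [sr' tr' E2]]] := @second_difference f u e' e r r0.
  move=> s' t' sr' tr'; have [Uv _ _] := Hr _ (inb _ _ _ _ N2 sr' tr').
  by split; [exact: smooth_differentiable sf Uv|exact: smooth_differentiable se' Uv].
have [_ H1 _] := Hr _ (inb _ _ _ _ N1 sr tr).
have [_ _ H2] := Hr _ (inb _ _ _ _ N2 sr' tr').
move: H1 H2 E1 E2.
move: ('D_(ebase j) ('D_(ebase i) f) (s *: e + (t *: e' + u))) => X1.
move: ('D_(ebase i) ('D_(ebase j) f) (s' *: e' + (t' *: e + u))) => X2.
move=> H1 H2; rewrite [r *: e' + (r *: e + u)]addrCA => E1 E2.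
have X12 : X1 = X2.
  have rN0 : r != 0 by rewrite gt_eqF.
  by apply: (mulIf rN0); apply: (mulIf rN0); rewrite -E1 -E2; ring.
have : d < d / 2 + d / 2.
  rewrite {1}/d -(subrKA X1); apply: le_lt_trans (ler_normD _ _) _.
  by apply: ltrD; [rewrite X12; exact: H2|rewrite distrC; exact: H1].
by rewrite -splitr ltxx.
Qed.

End schwarz.

(** * The Levi-Civita connection *)

Section levi_civita.
Context {R : realType} {n : nat}.
Implicit Types (X Y Z : 'rV[R]_n -> 'rV[R]_n) (u x y : 'rV[R]_n).

Lemma innerE (M : 'M[R]_n) x y :
  inner M x y = \sum_a \sum_b x 0 a * M a b * y 0 b.
Proof.
rewrite /inner mxE exchange_big /=; apply: eq_bigr => b _.
by rewrite !mxE mulr_suml.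
Qed.

Lemma innerDl (M : 'M[R]_n) x y z : inner M (x + y) z = inner M x z + inner M y z.
Proof. by rewrite /inner !mulmxDl mxE. Qed.

Lemma innerDr (M : 'M[R]_n) x y z : inner M x (y + z) = inner M x y + inner M x z.
Proof. by rewrite /inner linearD /= mulmxDr mxE. Qed.

Lemma innerZl (M : 'M[R]_n) a x y : inner M (a *: x) y = a * inner M x y.
Proof. by rewrite /inner -!scalemxAl mxE. Qed.

Lemma innerZr (M : 'M[R]_n) a x y : inner M x (a *: y) = a * inner M x y.
Proof. by rewrite /inner linearZ /= -scalemxAr mxE. Qed.

Lemma innerC (M : 'M[R]_n) x y : M^T = M -> inner M x y = inner M y x.
Proof.
move=> symM; rewrite /inner.
have -> : (x *m M *m y^T) 0 0 = (x *m M *m y^T)^T 0 0 by rewrite [RHS]mxE.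
by rewrite !trmx_mul trmxK symM mulmxA.
Qed.

Lemma is_derive_bigsum p (f : 'I_p -> 'rV[R]_n -> R) (df : 'I_p -> R) u x :
  (forall i, is_derive u x (f i) (df i)) ->
  is_derive u x (fun v => \sum_i f i v) (\sum_i df i).
Proof.
move=> H; have -> : (fun v => \sum_i f i v) = \sum_i f i.
  by apply/funext => v; rewrite fct_sumE.
exact: is_derive_sum.
Qed.

Lemma derive_dirD (V : normedModType R) (f : 'rV[R]_n -> V) u x y :
  differentiable f u -> 'D_(x + y) f u = 'D_x f u + 'D_y f u.
Proof. by move=> df; rewrite !deriveE // linearD. Qed.

Lemma derive_dirZ (V : normedModType R) (f : 'rV[R]_n -> V) u a x :
  differentiable f u -> 'D_(a *: x) f u = a *: 'D_x f u.
Proof. by move=> df; rewrite !deriveE // linearZ. Qed.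

Lemma derive_partials (f : 'rV[R]_n -> R) u x : differentiable f u ->
  'D_x f u = \sum_i x 0 i * 'D_(ebase i) f u.
Proof.
move=> df; rewrite deriveE // {1}[x]row_sum_delta linear_sum.
by apply: eq_bigr => i _; rewrite linearZ /= -deriveE.
Qed.

Variables (g : 'rV[R]_n -> 'M[R]_n) (U : set 'rV[R]_n).
Hypothesis oU : open U.
Hypothesis sg : smooth_on U g.
Hypothesis gsym : forall v, U v -> (g v)^T = g v.
Hypothesis gunit : forall v, U v -> g v \in unitmx.

Let dg u i j : U u -> differentiable (fun v => g v i j) u.
Proof. by move=> Uu; apply: smooth_differentiable Uu; exact: smooth_coord. Qed.

Lemma derive_metric_sym u x i j : U u ->
  'D_x (fun v => g v i j) u = 'D_x (fun v => g v j i) u.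
Proof.
by move=> Uu; apply: (open_derive_eq _ oU Uu) => v Uv; rewrite -[in LHS](gsym Uv) mxE.
Qed.

Lemma christoffel_sym u k i j : U u -> christoffel g k i j u = christoffel g k j i u.
Proof.
move=> Uu; rewrite /christoffel; congr (_ * _); apply: eq_bigr => l _.
by rewrite (derive_metric_sym _ i j Uu); congr (_ * _); ring.
Qed.

(** Lowering the index cancels the inverse metric, so later sums never expand [invmx]. *)
Lemma christoffel_lower u i j l : U u ->
  \sum_k christoffel g k i j u * g u k l =
  2^-1 * ('D_(ebase i) (fun v => g v j l) u + 'D_(ebase j) (fun v => g v i l) u
          - 'D_(ebase l) (fun v => g v i j) u).
Proof.
move=> Uu; pose r := \row_l0 ('D_(ebase i) (fun v => g v j l0) u
   + 'D_(ebase j) (fun v => g v i l0) u - 'D_(ebase l0) (fun v => g v i j) u).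
have -> : \sum_k christoffel g k i j u * g u k l =
    2^-1 * (r *m (g u *m invmx (g u))^T) 0 l.
  rewrite trmx_mul mulmxA mxE mulr_sumr; apply: eq_bigr => k _.
  rewrite /christoffel -mulrA; congr (_ * _).
  rewrite -[in RHS](gsym Uu) trmxK mxE; congr (_ * _).
  by apply: eq_bigr => l0 _; rewrite !mxE mulrC (gsym Uu).
by rewrite mulmxV ?gunit // trmx1 mulmx1 mxE.
Qed.

Let gamma u x y := \row_k \sum_i \sum_j christoffel g k i j u * x 0 i * y 0 j.

Let nablaE X Y u : nabla g X Y u = 'D_(X u) Y u + gamma u (X u) (Y u).
Proof. by []. Qed.

Let inner_gamma u x y z : U u -> inner (g u) (gamma u x y) z =
  \sum_i \sum_j \sum_l x 0 i * y 0 j * z 0 l *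
  (2^-1 * ('D_(ebase i) (fun v => g v j l) u + 'D_(ebase j) (fun v => g v i l) u
          - 'D_(ebase l) (fun v => g v i j) u)).
Proof.
move=> Uu; rewrite innerE exchange_big /=.
transitivity (\sum_l \sum_i \sum_j x 0 i * y 0 j * z 0 l *
    (\sum_k christoffel g k i j u * g u k l)).
  apply: eq_bigr => l _.
  transitivity (\sum_k \sum_i \sum_j
      christoffel g k i j u * x 0 i * y 0 j * g u k l * z 0 l).
    apply: eq_bigr => k _; rewrite mxE !mulr_suml; apply: eq_bigr => i _.
    by rewrite !mulr_suml.
  rewrite exchange_big; apply: eq_bigr => i _; rewrite exchange_big.
  apply: eq_bigr => j _; rewrite mulr_sumr; apply: eq_bigr => k _; ring.
rewrite exchange_big; apply: eq_bigr => i _; rewrite exchange_big.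
apply: eq_bigr => j _; apply: eq_bigr => l _; by rewrite christoffel_lower.
Qed.

(** When y and z are exchanged, the derivatives of g along y and z change sign; in the sum only the
    derivative along x remains. *)
Let gamma_metric u x y z : U u ->
  inner (g u) (gamma u x y) z + inner (g u) (gamma u x z) y =
  \sum_j \sum_l y 0 j * 'D_x (fun v => g v j l) u * z 0 l.
Proof.
move=> Uu; rewrite !inner_gamma //.
transitivity (\sum_i \sum_j \sum_l x 0 i * y 0 j * z 0 l *
    'D_(ebase i) (fun v => g v j l) u).
  rewrite -big_split; apply: eq_bigr => i _ /=.
  rewrite [X in _ + X = _]exchange_big -big_split; apply: eq_bigr => j _ /=.
  rewrite -big_split; apply: eq_bigr => l _ /=.
  by rewrite (derive_metric_sym _ l j Uu); field.
rewrite exchange_big; apply: eq_bigr => j _; rewrite exchange_big.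
apply: eq_bigr => l _; rewrite (derive_partials x (dg j l Uu)) mulr_sumr mulr_suml.
by apply: eq_bigr => i _; ring.
Qed.

Lemma nabla_torsion X Y u : U u ->
  nabla g X Y u - nabla g Y X u = lie_bracket X Y u.
Proof.
move=> Uu; rewrite !nablaE /lie_bracket.
have -> : gamma u (X u) (Y u) = gamma u (Y u) (X u).
  apply/rowP => k; rewrite !mxE exchange_big; apply: eq_bigr => i _.
  by apply: eq_bigr => j _; rewrite (christoffel_sym _ _ _ Uu) mulrAC.
by rewrite opprD addrACA subrr addr0.
Qed.

Lemma nabla_metric X Y Z u : U u -> differentiable Y u -> differentiable Z u ->
  'D_(X u) (fun v => inner (g v) (Y v) (Z v)) u =
  inner (g u) (nabla g X Y u) (Z u) + inner (g u) (Y u) (nabla g X Z u).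
Proof.
move=> Uu dY dZ; have sym := gsym Uu; set x := X u.
have dco (W : 'rV[R]_n -> 'rV[R]_n) a : differentiable W u ->
    is_derive u x (fun v => W v 0 a) (('D_x W u) 0 a).
  move=> dW; rewrite -derive_coord //; apply/derivableP.
  by apply: (derivable_mxP _ _ _).1; exact: diff_derivable.
have H : is_derive u x (fun v => \sum_a \sum_b Y v 0 a * g v a b * Z v 0 b)
  (\sum_a \sum_b (Y u 0 a * g u a b * ('D_x Z u) 0 b +
     (Y u 0 a * 'D_x (fun v => g v a b) u + ('D_x Y u) 0 a * g u a b) * Z u 0 b)).
  apply: is_derive_bigsum => a; apply: is_derive_bigsum => b.
  apply: is_derive_mul; last exact: dco.
  apply: is_derive_mul; first exact: dco.
  by apply/derivableP/diff_derivable/dg.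
have -> : (fun v => inner (g v) (Y v) (Z v)) =
    (fun v => \sum_a \sum_b Y v 0 a * g v a b * Z v 0 b).
  by apply/funext => v; rewrite innerE.
rewrite (@derive_val _ _ _ _ _ _ _ H) !nablaE innerDl innerDr.
rewrite addrACA [inner _ (Y u) (gamma _ _ _)]innerC // gamma_metric // !innerE -/x.
rewrite -!big_split; apply: eq_bigr => j _; rewrite -!big_split.
by apply: eq_bigr => l _ /=; ring.
Qed.

Lemma nablaD X Y Z u : differentiable Y u -> differentiable Z u ->
  nabla g X (fun v => Y v + Z v) u = nabla g X Y u + nabla g X Z u.
Proof.
move=> dY dZ; rewrite !nablaE (@deriveD _ _ _ Y Z); try exact: diff_derivable.
rewrite addrACA; congr (_ + _); apply/rowP => k; rewrite !mxE -big_split.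
by apply: eq_bigr => i _; rewrite -big_split; apply: eq_bigr => j _; rewrite mxE mulrDr.
Qed.

Lemma differentiable_scale (a : 'rV[R]_n -> R) Y u :
  differentiable a u -> differentiable Y u -> differentiable (fun v => a v *: Y v) u.
Proof.
move=> da dY; apply: differentiable_mx => i j.
rewrite [X in differentiable X u](_ : _ = fun v => a v * Y v i j); last first.
  by apply/funext => v; rewrite mxE.
apply: (@differentiableM _ _ a (fun v => Y v i j)) => //.
apply: (@differentiable_comp _ _ _ _ Y (fun M : 'rV[R]_n => M i j)) => //.
exact: differentiable_coord.
Qed.

Lemma nablaZ X (a : 'rV[R]_n -> R) Y u : differentiable a u -> differentiable Y u ->
  nabla g X (fun v => a v *: Y v) u = 'D_(X u) a u *: Y u + a u *: nabla g X Y u.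
Proof.
move=> da dY; rewrite !nablaE.
have -> : 'D_(X u) (fun v => a v *: Y v) u = 'D_(X u) a u *: Y u + a u *: 'D_(X u) Y u.
  apply/rowP => k; rewrite -derive_coord; last exact: differentiable_scale.
  rewrite (_ : (fun v => _) = fun v => a v * Y v 0 k); last first.
    by apply/funext => v; rewrite mxE.
  rewrite (@deriveM _ _ a (fun v => Y v 0 k)); first last.
  - by apply: (derivable_mxP _ _ _).1; exact: diff_derivable.
  - exact: diff_derivable.
  by rewrite derive_coord // !mxE addrC; congr (_ + _); rewrite [LHS]mulrC.
rewrite scalerDr addrA; congr (_ + _); apply/rowP => k; rewrite !mxE mulr_sumr.
by apply: eq_bigr => i _; rewrite mulr_sumr; apply: eq_bigr => j _; rewrite mxE; ring.
Qed.

(** Only the value of the direction field at the point matters for [nabla], so constant fields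
    suffice. *)
Lemma nabla_dirD x y Y u : differentiable Y u ->
  nabla g (cst (x + y)) Y u = nabla g (cst x) Y u + nabla g (cst y) Y u.
Proof.
move=> dY; rewrite !nablaE /= derive_dirD // addrACA; congr (_ + _).
apply/rowP => k; rewrite !mxE -big_split; apply: eq_bigr => i _.
by rewrite -big_split; apply: eq_bigr => j _; rewrite mxE /=; ring.
Qed.

Lemma nabla_dirZ a x Y u : differentiable Y u ->
  nabla g (cst (a *: x)) Y u = a *: nabla g (cst x) Y u.
Proof.
move=> dY; rewrite !nablaE /= derive_dirZ // scalerDr; congr (_ + _).
apply/rowP => k; rewrite !mxE mulr_sumr; apply: eq_bigr => i _.
by rewrite mulr_sumr; apply: eq_bigr => j _; rewrite mxE; ring.
Qed.

End levi_civita.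

(** * Orthonormal frames on a surface *)

(** The leaves are closed by [auto], so the smoothness of the atoms must be in the context, possibly
    quantified over indices. *)
Ltac smooth oU :=
  lazymatch goal with
  | |- smooth_on _ (fun v => @?f v + @?h v) =>
      apply: (@smooth_add _ _ _ f h oU); smooth oU
  | |- smooth_on _ (fun v => @?f v * @?h v) =>
      apply: (@smooth_mul _ _ _ f h oU); smooth oU
  | |- smooth_on _ (fun v => - @?f v) => apply: (@smooth_opp _ _ _ f oU); smooth oU
  | |- smooth_on _ (fun v => expR (@?f v)) => apply: (@smooth_exp _ _ _ f oU); smooth oU
  | |- smooth_on _ (fun _ => ?c) => exact: smooth_const
  | |- _ => by auto
  end.

(** A constant left factor is handled by [is_derive_scale], so that no product with a zero
    derivative appears and the result matches the stated one syntactically. *)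
Ltac derive_rules oU Uu :=
  lazymatch goal with
  | |- is_derive _ _ (fun v => @?f v + @?h v) _ =>
      apply: (@is_derive_add _ _ f h); derive_rules oU Uu
  | |- is_derive _ _ (fun v => @?f v * @?h v) _ =>
      lazymatch f with
      | (fun _ => ?c) => apply: (@is_derive_scale _ _ c h)
      | _ => apply: (@is_derive_mul _ _ f h)
      end; derive_rules oU Uu
  | |- is_derive _ _ (fun v => - @?f v) _ =>
      apply: (@is_derive_opp _ _ f); derive_rules oU Uu
  | |- is_derive _ _ (fun _ => ?c) _ => exact: is_derive_const
  | |- is_derive _ _ ?f _ => apply: (@smooth_is_derive _ _ _ _ f _ _ _ Uu); smooth oU
  end.

Lemma ord2P (i : 'I_2) : i = 0 \/ i = 1.
Proof. by case: i => [[|[|//]] ?]; [left|right]; exact: val_inj. Qed.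

Lemma sum2 (V : nmodType) (f : 'I_2 -> V) : \sum_i f i = f 0 + f 1.
Proof.
by rewrite big_ord_recl big_ord_recl big_ord0 addr0; congr (_ + f _); exact: val_inj.
Qed.

Lemma sum3 (V : nmodType) (f : 'I_3 -> V) : \sum_i f i = f 0 + f 1 + f 2.
Proof.
rewrite !big_ord_recl big_ord0 addr0 addrA.
by congr (_ + f _ + f _); exact: val_inj.
Qed.

Definition frame_derive {R : realType} (F : 'I_2 -> 'rV[R]_2 -> 'rV[R]_2) (i : 'I_2)
  (h : 'rV[R]_2 -> R) (v : 'rV[R]_2) : R := 'D_(F i v) h v.

Definition frame_vec {R : realType} (F : 'I_2 -> 'rV[R]_2 -> 'rV[R]_2)
  (a b : 'rV[R]_2 -> R) (v : 'rV[R]_2) : 'rV[R]_2 := a v *: F 0 v + b v *: F 1 v.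

(* The connection form: nabla_X F0 = w(X) F1 and nabla_X F1 = - w(X) F0. *)
Definition frame_form {R : realType} (g : 'rV[R]_2 -> 'M[R]_2)
  (F : 'I_2 -> 'rV[R]_2 -> 'rV[R]_2) (i : 'I_2) (v : 'rV[R]_2) : R :=
  inner (g v) (nabla g (F i) (F 0) v) (F 1 v).

Section frame.
Context {R : realType}.
Variables (g : 'rV[R]_2 -> 'M[R]_2) (U : set 'rV[R]_2).
Variable (F : 'I_2 -> 'rV[R]_2 -> 'rV[R]_2).
Hypothesis oU : open U.
Hypothesis sg : smooth_on U g.
Hypothesis gsym : forall v, U v -> (g v)^T = g v.
Hypothesis hF : orthonormal_frame_on g U F.
Implicit Types (u v x : 'rV[R]_2) (i j : 'I_2) (h : 'rV[R]_2 -> R).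

Local Notation D := (frame_derive F).
Local Notation w := (frame_form g F).

Let sF i : smooth_on U (F i). Proof. by have [+ _] := hF. Qed.

Let dF i u : U u -> differentiable (F i) u.
Proof. by move=> Uu; exact: smooth_differentiable (sF i) Uu. Qed.

Let frame_orth i j u : U u -> inner (g u) (F i u) (F j u) = (i == j)%:R.
Proof. by move=> Uu; have [_] := hF; exact. Qed.

Let frame_mx u := \matrix_i F i u.

Let frame_mx_sandwich u (N : 'M[R]_2) i j :
  (frame_mx u *m N *m (frame_mx u)^T) i j = (F i u *m N *m (F j u)^T) 0 0.
Proof.
rewrite !mxE; apply: eq_bigr => b _; rewrite !mxE; congr (_ * _).
by apply: eq_bigr => a _; rewrite !mxE.
Qed.

Let frame_mx1 u : U u -> frame_mx u *m (g u *m (frame_mx u)^T) = 1%:M.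
Proof.
move=> Uu; apply/matrixP => i j; rewrite mulmxA frame_mx_sandwich [RHS]mxE.
exact: frame_orth.
Qed.

(** For the matrix M with rows F0, F1, orthonormality reads M g M^T = 1, which makes g
    invertible. *)
Lemma frame_metric_unit u : U u -> g u \in unitmx.
Proof.
by move=> /frame_mx1 /mulmx1_unit [_]; rewrite unitmx_mul => /andP[].
Qed.

(** For square matrices a right inverse is a left inverse, so M (g M^T) = 1 turns into (g M^T) M =
    1, which is the expansion. *)
Lemma frame_expand u x : U u ->
  x = inner (g u) x (F 0 u) *: F 0 u + inner (g u) x (F 1 u) *: F 1 u.
Proof.
move=> Uu; have E := mulmx1C (frame_mx1 Uu).
rewrite -[LHS]mulmx1 -E mulmxA mulmx_sum_row sum2 !rowK.
by congr (_ *: _ + _ *: _); rewrite /inner !mulmxA !mxE; apply: eq_bigr => b _; rewrite !mxE.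
Qed.

Lemma frame_trace u (M : 'M[R]_2) : U u ->
  \tr M = inner (g u) (F 0 u *m M) (F 0 u) + inner (g u) (F 1 u *m M) (F 1 u).
Proof.
move=> Uu; have E := mulmx1C (frame_mx1 Uu).
have -> : \tr M = \tr (frame_mx u *m (M *m g u) *m (frame_mx u)^T).
  by rewrite -[in LHS](mulmx1 M) -E [in LHS]mulmxA [LHS]mxtrace_mulC !mulmxA.
by rewrite /mxtrace sum2 !frame_mx_sandwich /inner !mulmxA.
Qed.

Lemma inner_frame u (a b c d : R) : U u ->
  inner (g u) (a *: F 0 u + b *: F 1 u) (c *: F 0 u + d *: F 1 u) = a * c + b * d.
Proof.
move=> Uu; rewrite !innerDl !innerDr !innerZl !innerZr !frame_orth //=.
by ring.
Qed.

Lemma inner_frame0 u (a b : R) : U u ->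
  inner (g u) (a *: F 0 u + b *: F 1 u) (F 0 u) = a.
Proof.
by move=> Uu; rewrite -[X in inner _ _ X](_ : 1 *: F 0 u + 0 *: F 1 u = _)
  ?inner_frame ?mulr1 ?mulr0 ?addr0 // scale1r scale0r addr0.
Qed.

Lemma inner_frame1 u (a b : R) : U u ->
  inner (g u) (a *: F 0 u + b *: F 1 u) (F 1 u) = b.
Proof.
by move=> Uu; rewrite -[X in inner _ _ X](_ : 0 *: F 0 u + 1 *: F 1 u = _)
  ?inner_frame ?mulr1 ?mulr0 ?add0r // scale1r scale0r add0r.
Qed.

Let nabla_skew i j k u : U u ->
  inner (g u) (nabla g (F i) (F j) u) (F k u) + inner (g u) (nabla g (F i) (F k) u) (F j u) = 0.
Proof.
move=> Uu; rewrite [X in _ + X]innerC ?gsym //.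
have H := @nabla_metric _ _ g U oU sg gsym frame_metric_unit.
rewrite -(H (F i) (F j) (F k)) //; try exact: dF.
rewrite (@open_derive_eq _ _ _ U _ (fun=> (j == k)%:R : R)) //; first exact: derive_cst.
by move=> v Uv; exact: frame_orth.
Qed.

(** This evaluates the coefficient [wx] of [nabla_frame_vec] at a frame vector. *)
Lemma frame_form_dir i u : U u ->
  inner (g u) (F i u) (F 0 u) * w 0 u + inner (g u) (F i u) (F 1 u) * w 1 u = w i u.
Proof.
move=> Uu; rewrite !frame_orth //; case: (ord2P i) => -> /=; first by rewrite mul1r mul0r addr0.
by rewrite mul1r mul0r add0r.
Qed.

Lemma nabla_frame0 i u : U u -> nabla g (F i) (F 0) u = w i u *: F 1 u.
Proof.
move=> Uu; have /eqP := nabla_skew i 0 0 Uu.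
rewrite -mulr2n mulrn_eq0 /= => /eqP E.
by rewrite {1}(frame_expand (nabla g (F i) (F 0) u) Uu) E scale0r add0r.
Qed.

Lemma nabla_frame1 i u : U u -> nabla g (F i) (F 1) u = - w i u *: F 0 u.
Proof.
move=> Uu; have /eqP := nabla_skew i 1 1 Uu.
rewrite -mulr2n mulrn_eq0 /= => /eqP E.
rewrite {1}(frame_expand (nabla g (F i) (F 1) u) Uu) E scale0r addr0.
have := nabla_skew i 1 0 Uu; move/eqP; rewrite addr_eq0 => /eqP -> //.
Qed.

(* Torsion-freeness determines the connection form from the bracket, which is
   why no Koszul formula is needed. *)
Lemma frame_bracket u : U u ->
  lie_bracket (F 0) (F 1) u = (- w 0 u) *: F 0 u + (- w 1 u) *: F 1 u.
Proof.
move=> Uu; rewrite -(@nabla_torsion _ _ g U oU gsym) //.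
by rewrite nabla_frame0 // nabla_frame1 // (scaleNr (w 1 u)).
Qed.

Lemma smooth_frame_derive i h : smooth_on U h -> smooth_on U (D i h).
Proof.
move=> sh; apply: (@smooth_on_eq _ _ _ _
  (fun v => \sum_a F i v 0 a * 'D_(ebase a) h v)) => // [v Uv|].
  by rewrite -derive_partials //; exact: smooth_differentiable sh Uv.
apply: smooth_sum => // a; have := smooth_coord 0 a oU (sF i).
by have := smooth_partial a sh; move=> *; smooth oU.
Qed.

(** By [frame_bracket], w is minus the component of [F0, F1] along F_i. This expresses it by
    derivatives of the frame coordinates and by g, with no inverse of the metric. *)
Lemma smooth_frame_form i : smooth_on U (w i).
Proof.
have sFc j b := smooth_coord 0 b oU (sF j).
have sD j k b := smooth_frame_derive k (sFc j b).
have sgc a b := smooth_coord a b oU sg.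
apply: (@smooth_on_eq _ _ _ _ (fun v => \sum_a \sum_b
  (- (D 0 (fun v => F 1 v 0 a) v - D 1 (fun v => F 0 v 0 a) v)) * g v a b * F i v 0 b)) => //.
  move=> v Uv; have -> : w i v = - inner (g v) (lie_bracket (F 0) (F 1) v) (F i v).
    rewrite frame_bracket //; case: (ord2P i) => ->.
    - by rewrite inner_frame0 // opprK.
    - by rewrite inner_frame1 // opprK.
  rewrite innerE -sumrN; apply: eq_bigr => a _; rewrite -sumrN; apply: eq_bigr => b _.
  rewrite !mxE /frame_derive !derive_coord; try exact: dF.
  by ring.
apply: smooth_sum => // a; apply: smooth_sum => // b; smooth oU.
Qed.

Lemma derive_along u (r s : R) h : smooth_on U h -> U u ->
  'D_(r *: F 0 u + s *: F 1 u) h u = r * D 0 h u + s * D 1 h u.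
Proof.
move=> sh Uu; have dh := smooth_differentiable sh Uu.
by rewrite derive_dirD // !derive_dirZ.
Qed.

(** In coordinates the second-order terms of both sides agree by [schwarz]; the first-order terms
    form the derivative along [F0, F1], known from [frame_bracket]. *)
Lemma frame_commute h u : smooth_on U h -> U u ->
  D 0 (D 1 h) u = D 1 (D 0 h) u - w 0 u * D 0 h u - w 1 u * D 1 h u.
Proof.
move=> sh Uu; have dh := smooth_differentiable sh Uu.
have sFc j b := smooth_coord 0 b oU (sF j).
have sp b := smooth_partial b sh.
have E i j : D i (D j h) u =
    (\sum_a \sum_b F i u 0 b * F j u 0 a * 'D_(ebase b) ('D_(ebase a) h) u) +
    'D_('D_(F i u) (F j) u) h u.
  rewrite (derive_partials _ dh) {1}/frame_derive (@open_derive_eq _ _ _ U _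
    (fun v => \sum_a F j v 0 a * 'D_(ebase a) h v) _ _ oU Uu); last first.
    by move=> v Uv; rewrite -derive_partials //; exact: smooth_differentiable sh Uv.
  rewrite -big_split /=; apply: derive_val; apply: is_derive_bigsum => a.
  have -> : \sum_b F i u 0 b * F j u 0 a * 'D_(ebase b) ('D_(ebase a) h) u =
     F j u 0 a * 'D_(F i u) ('D_(ebase a) h) u.
    rewrite (derive_partials (F i u)); last exact: smooth_differentiable (sp a) Uu.
    by rewrite mulr_sumr; apply: eq_bigr => b _; ring.
  rewrite -derive_coord; last exact: dF.
  derive_rules oU Uu.
have S : \sum_a \sum_b F 0 u 0 b * F 1 u 0 a * 'D_(ebase b) ('D_(ebase a) h) u =
         \sum_a \sum_b F 1 u 0 b * F 0 u 0 a * 'D_(ebase b) ('D_(ebase a) h) u.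
  rewrite exchange_big; apply: eq_bigr => a _; apply: eq_bigr => b _.
  by rewrite (schwarz a b oU sh Uu) [F 0 u 0 a * _]mulrC.
have B : 'D_('D_(F 0 u) (F 1) u) h u - 'D_('D_(F 1 u) (F 0) u) h u =
         - w 0 u * D 0 h u + - w 1 u * D 1 h u.
  rewrite -(derive_along _ _ sh Uu) -frame_bracket // /lie_bracket.
  by rewrite -[- 'D_(F 1 u) (F 0) u]scaleN1r (derive_dirD _ _ dh) (derive_dirZ _ _ dh) scaleN1r.
have lin (r p q c d : R) : p - q = c + d -> r + p = r + q + c + d.
  by move=> H; rewrite -!addrA -H [q + _]addrC subrK.
by rewrite (E 0 1) (E 1 0) S -!mulNr; exact: lin B.
Qed.

Lemma differentiable_frame_vec (a b : 'rV[R]_2 -> R) u : smooth_on U a -> smooth_on U b -> U u ->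
  differentiable (frame_vec F a b) u.
Proof.
move=> sa sb Uu.
apply: (@differentiableD _ _ _ (fun v => a v *: F 0 v) (fun v => b v *: F 1 v)).
  by apply: differentiable_scale; [exact: smooth_differentiable Uu|exact: dF].
by apply: differentiable_scale; [exact: smooth_differentiable Uu|exact: dF].
Qed.

(** The coefficients are differentiated and then rotated infinitesimally by [wx], the connection
    form evaluated on x. *)
Lemma nabla_frame_vec x (a b : 'rV[R]_2 -> R) u : smooth_on U a -> smooth_on U b -> U u ->
  let wx := inner (g u) x (F 0 u) * w 0 u + inner (g u) x (F 1 u) * w 1 u in
  nabla g (cst x) (frame_vec F a b) u =
  ('D_x a u - wx * b u) *: F 0 u + ('D_x b u + wx * a u) *: F 1 u.
Proof.
move=> sa sb Uu wx.
have da := smooth_differentiable sa Uu; have db := smooth_differentiable sb Uu.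
have dF0 := dF 0 Uu; have dF1 := dF 1 Uu.
rewrite /frame_vec nablaD; try exact: differentiable_scale.
rewrite !nablaZ //=.
have N j : nabla g (cst x) (F j) u =
    inner (g u) x (F 0 u) *: nabla g (F 0) (F j) u +
    inner (g u) x (F 1 u) *: nabla g (F 1) (F j) u.
  rewrite {1}(frame_expand x Uu) nabla_dirD ?nabla_dirZ //; exact: dF.
rewrite !N !nabla_frame0 // !nabla_frame1 // !scalerDr !scalerA /wx.
apply/rowP => k; rewrite !mxE; ring.
Qed.

Lemma nabla_eq X (Y Z : 'rV[R]_2 -> 'rV[R]_2) u : U u ->
  (forall v, U v -> Y v = Z v) -> nabla g X Y u = nabla g X Z u.
Proof. by move=> Uu YZ; rewrite /nabla (open_derive_eq _ oU Uu YZ) (YZ _ Uu). Qed.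

Lemma divergence_eq (Y Z : 'rV[R]_2 -> 'rV[R]_2) u : U u ->
  (forall v, U v -> Y v = Z v) -> divergence g Y u = divergence g Z u.
Proof. by move=> Uu YZ; apply: eq_bigr => i _; rewrite (nabla_eq _ Uu YZ). Qed.

Lemma divergence_frame_vec (a b : 'rV[R]_2 -> R) u : smooth_on U a -> smooth_on U b -> U u ->
  divergence g (frame_vec F a b) u =
  D 0 a u + D 1 b u + a u * w 1 u - b u * w 0 u.
Proof.
move=> sa sb Uu; have dV := differentiable_frame_vec sa sb Uu.
(* The divergence is defined by a trace in the coordinate basis; as the trace of an endomorphism it
   can be taken in the orthonormal frame. *)
pose M := \matrix_i nabla g (cst (ebase i)) (frame_vec F a b) u.
have -> : divergence g (frame_vec F a b) u = \tr M.
  by apply: eq_bigr => i _; rewrite [RHS]mxE.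
have ME x : x *m M = nabla g (cst x) (frame_vec F a b) u.
  rewrite mulmx_sum_row sum2 !rowK -!nabla_dirZ // -nabla_dirD //.
  by rewrite {3}[x]row_sum_delta sum2.
rewrite (frame_trace _ Uu) !ME !nabla_frame_vec // inner_frame0 // inner_frame1 //.
rewrite !frame_orth //= /frame_derive; ring.
Qed.

Lemma grad_frame h u : smooth_on U h -> U u ->
  grad g h u = frame_vec F (D 0 h) (D 1 h) u.
Proof.
move=> sh Uu; rewrite [LHS](frame_expand _ Uu) /frame_vec.
have E i : inner (g u) (grad g h u) (F i u) = D i h u.
  rewrite /inner /grad mulmxKV ?frame_metric_unit // /frame_derive derive_partials.
    by rewrite mxE; apply: eq_bigr => j _; rewrite !mxE mulrC.
  exact: smooth_differentiable sh Uu.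
by rewrite !E.
Qed.

Lemma laplacian_frame h u : smooth_on U h -> U u ->
  laplacian g h u = D 0 (D 0 h) u + D 1 (D 1 h) u + D 0 h u * w 1 u - D 1 h u * w 0 u.
Proof.
move=> sh Uu.
rewrite /laplacian (divergence_eq Uu (fun v Uv => grad_frame sh Uv)).
by rewrite divergence_frame_vec //; exact: smooth_frame_derive.
Qed.

Lemma grad_eq (h k : 'rV[R]_2 -> R) u : U u ->
  (forall v, U v -> h v = k v) -> grad g h u = grad g k u.
Proof.
move=> Uu hk; rewrite /grad; congr (_ *m _); apply/rowP => j; rewrite !mxE.
exact: open_derive_eq hk.
Qed.

Lemma laplacian_eq (h k : 'rV[R]_2 -> R) u : U u ->
  (forall v, U v -> h v = k v) -> laplacian g h u = laplacian g k u.
Proof.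
by move=> Uu hk; apply: divergence_eq => // v Uv; exact: grad_eq.
Qed.

End frame.

(* At a point: a_ik are the components of the coordinate field e_i in the frame,
   W_i the connection form on e_i, (p_ij, q_ij) the components of nabla_(e_i) e_j,
   w_ij the derivative of w_j along F_i, and a prefix d_i (or d) an
   e_i-derivative. *)
Lemma gauss_curvature_algebra (K : fieldType) (a00 a01 a10 a11 w0 w1
    W0 W1 dW0 dW1 w00 w01 w10 w11 d0w0 d0w1 d1w0 d1w1
    d0a10 d0a11 d1a10 d1a11 d1a00 d1a01 p11 p01 p10 q11 q01 q10
    dp11 dp01 dq11 dq01 s0 s0' s1 s1' : K) :
  W0 = a00 * w0 + a01 * w1 -> W1 = a10 * w0 + a11 * w1 ->
  dW0 = a00 * d1w0 + d1a00 * w0 + (a01 * d1w1 + d1a01 * w1) ->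
  dW1 = a10 * d0w0 + d0a10 * w0 + (a11 * d0w1 + d0a11 * w1) ->
  d0w0 = a00 * w00 + a01 * w10 -> d0w1 = a00 * w01 + a01 * w11 ->
  d1w0 = a10 * w00 + a11 * w10 -> d1w1 = a10 * w01 + a11 * w11 ->
  dp11 = s0 - (W1 * d0a11 + dW1 * a11) -> dp01 = s0' - (W0 * d1a11 + dW0 * a11) ->
  dq11 = s1 + (W1 * d0a10 + dW1 * a10) -> dq01 = s1' + (W0 * d1a10 + dW0 * a10) ->
  s0 = s0' -> s1 = s1' ->
  p11 = d1a10 - W1 * a11 -> p01 = d0a10 - W0 * a11 -> p10 = d1a00 - W1 * a01 ->
  q11 = d1a11 + W1 * a10 -> q01 = d0a11 + W0 * a10 -> q10 = d1a01 + W1 * a00 ->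
  p01 = p10 -> q01 = q10 -> a00 * a11 - a01 * a10 != 0 ->
  ((dp11 - W0 * q11 - (dp01 - W1 * q01)) * a00 +
   (dq11 + W0 * p11 - (dq01 + W1 * p01)) * a01) /
  ((a00 * a00 + a01 * a01) * (a10 * a10 + a11 * a11) - (a00 * a10 + a01 * a11) ^+ 2)
  = - (w01 - w10 + w0 ^+ 2 + w1 ^+ 2).
Proof.
move=> -> -> -> -> -> -> -> -> -> -> -> -> -> -> -> -> -> -> -> -> flat0 flat1 det0.
(* The vanishing torsion of the coordinate fields is solved for [d0a10] and [d0a11]. *)
have -> : d0a10 = d1a00 - (a10 * w0 + a11 * w1) * a01 + (a00 * w0 + a01 * w1) * a11.
  by rewrite -flat0; ring.
have -> : d0a11 = d1a01 + (a10 * w0 + a11 * w1) * a00 - (a00 * w0 + a01 * w1) * a10.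
  by rewrite -flat1; ring.
have den0 : (a00 * a00 + a01 * a01) * (a10 * a10 + a11 * a11) -
            (a00 * a10 + a01 * a11) ^+ 2 != 0.
  (* Lagrange's identity: the Gram determinant is the square of the determinant of the frame
     components. *)
  rewrite (_ : _ - _ = (a00 * a11 - a01 * a10) ^+ 2); last by ring.
  by rewrite expf_neq0.
by apply: (mulIf den0); rewrite divfK //; ring.
Qed.

(** * The Gaussian curvature from the connection form *)

Section gauss_curvature_frame.
Context {R : realType}.
Variables (g : 'rV[R]_2 -> 'M[R]_2) (U : set 'rV[R]_2).
Variable (F : 'I_2 -> 'rV[R]_2 -> 'rV[R]_2).
Hypothesis oU : open U.
Hypothesis sg : smooth_on U g.
Hypothesis gsym : forall v, U v -> (g v)^T = g v.
Hypothesis hF : orthonormal_frame_on g U F.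

Local Notation D := (frame_derive F).
Local Notation w := (frame_form g F).

Let coef (i k : 'I_2) (v : 'rV[R]_2) : R := inner (g v) (ebase i) (F k v).
Let W (i : 'I_2) (v : 'rV[R]_2) : R := coef i 0 v * w 0 v + coef i 1 v * w 1 v.
Let P (i j : 'I_2) (v : 'rV[R]_2) : R := 'D_(ebase i) (coef j 0) v - W i v * coef j 1 v.
Let Q (i j : 'I_2) (v : 'rV[R]_2) : R := 'D_(ebase i) (coef j 1) v + W i v * coef j 0 v.

Let scoef i k : smooth_on U (coef i k).
Proof.
have sF : smooth_on U (F k) by have [+ _] := hF.
apply: (@smooth_on_eq _ _ _ _ (fun v => \sum_b g v i b * F k v 0 b)) => //.
  move=> v Uv; apply/esym; rewrite /coef innerE (bigD1 i) //= [X in _ + X]big1 ?addr0.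
    by apply: eq_bigr => b _; rewrite mxE !eqxx mul1r.
  by move=> a ai; apply: big1 => b _; rewrite mxE eqxx (negbTE ai) !mul0r.
apply: smooth_sum => // b; have := smooth_coord i b oU sg.
by have := smooth_coord 0 b oU sF; move=> *; smooth oU.
Qed.

Let sw i : smooth_on U (w i).
Proof. exact: smooth_frame_form. Qed.

Let sW i : smooth_on U (W i).
Proof. rewrite /W; smooth oU. Qed.

Let spc i j k : smooth_on U ('D_(ebase i) (coef j k)).
Proof. exact: smooth_partial. Qed.

Let sP i j : smooth_on U (P i j).
Proof. rewrite /P; smooth oU. Qed.

Let sQ i j : smooth_on U (Q i j).
Proof. rewrite /Q; smooth oU. Qed.

Let ebase_frame i v : U v -> ebase i = frame_vec F (coef i 0) (coef i 1) v.
Proof. by move=> Uv; exact: (frame_expand hF (ebase i) Uv). Qed.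

Let nabla_ebase i j v : U v ->
  nabla g (cst (ebase i)) (cst (ebase j)) v = frame_vec F (P i j) (Q i j) v.
Proof.
move=> Uv; rewrite (nabla_eq g oU _ Uv (fun v Uv => ebase_frame j Uv)).
by rewrite (nabla_frame_vec oU sg gsym hF).
Qed.

Let nabla_nabla_ebase i j v (k := ebase i) : U v ->
  nabla g (cst (ebase i)) (nabla g (cst (ebase j)) (cst (ebase 1))) v =
  ('D_k (P j 1) v - W i v * Q j 1 v) *: F 0 v + ('D_k (Q j 1) v + W i v * P j 1 v) *: F 1 v.
Proof.
move=> Uv; rewrite (nabla_eq g oU _ Uv (fun v Uv => nabla_ebase j 1 Uv)).
by rewrite (nabla_frame_vec oU sg gsym hF).
Qed.

Let derive_ebase i (h : 'rV[R]_2 -> R) u : smooth_on U h -> U u ->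
  'D_(ebase i) h u = coef i 0 u * D 0 h u + coef i 1 u * D 1 h u.
Proof.
move=> sh Uu; rewrite [X in 'D_X h u](ebase_frame i Uu) /frame_vec.
by rewrite (derive_along F _ _ sh Uu).
Qed.

Let bracket0 u : lie_bracket (cst (ebase 0)) (cst (ebase 1)) u = 0 :> 'rV[R]_2.
Proof. by rewrite /lie_bracket !derive_cst subrr. Qed.

Let flat u : U u -> P 0 1 u = P 1 0 u /\ Q 0 1 u = Q 1 0 u.
Proof.
move=> Uu.
have : nabla g (cst (ebase 0)) (cst (ebase 1)) u = nabla g (cst (ebase 1)) (cst (ebase 0)) u.
  apply/eqP; rewrite -subr_eq0.
  by rewrite (@nabla_torsion _ _ g U oU gsym) // bracket0.
rewrite !nabla_ebase // /frame_vec => E.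
split.
  by have := congr1 (fun x => inner (g u) x (F 0 u)) E; rewrite !(inner_frame0 hF).
by have := congr1 (fun x => inner (g u) x (F 1 u)) E; rewrite !(inner_frame1 hF).
Qed.

(** The coordinates of the frame fields and [coef] form mutually inverse matrices, so their
    determinants multiply to 1. *)
Let coef_det u : U u -> coef 0 0 u * coef 1 1 u - coef 0 1 u * coef 1 0 u != 0.
Proof.
move=> Uu; have E i k : (i == k)%:R = F i u 0 0 * coef 0 k u + F i u 0 1 * coef 1 k u.
  have [_ /(_ u Uu i k) <-] := hF.
  by rewrite {1}[F i u]row_sum_delta sum2 innerDl !innerZl.
have : (F 0 u 0 0 * F 1 u 0 1 - F 0 u 0 1 * F 1 u 0 0) *
       (coef 0 0 u * coef 1 1 u - coef 0 1 u * coef 1 0 u) = 1.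
  have := E 0 0; have := E 0 1; have := E 1 0; have := E 1 1; rewrite /=.
  move: (coef 0 0 u) (coef 0 1 u) (coef 1 0 u) (coef 1 1 u) => a b c d.
  move: (F 0 u 0 0) (F 0 u 0 1) (F 1 u 0 0) (F 1 u 0 1) => p q r s E11 E10 E01 E00.
  transitivity ((p * a + q * c) * (r * b + s * d) - (r * a + s * c) * (p * b + q * d)).
    by ring.
  by rewrite -E00 -E11 -E10 -E01; ring.
by apply: contra_eq_neq => ->; rewrite mulr0 eq_sym oner_eq0.
Qed.

(** The right side is - dw(F0, F1); the squares are the term - w([F0, F1]) of dw. As
    [gauss_curvature] is defined on coordinate fields, these are expanded in the frame. *)
Lemma gauss_curvature_frame u : U u ->
  gauss_curvature g u = - (D 0 (w 1) u - D 1 (w 0) u + w 0 u ^+ 2 + w 1 u ^+ 2).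
Proof.
move=> Uu; rewrite /gauss_curvature /curvature.
have -> : nabla g (lie_bracket (cst (ebase 0)) (cst (ebase 1))) (cst (ebase 1)) u = 0.
  (* The zero direction is written as a multiple [0 *: 0] so that [nabla_dirZ] applies. *)
  have -> : nabla g (lie_bracket (cst (ebase 0)) (cst (ebase 1))) (cst (ebase 1)) u =
            nabla g (cst (0 *: 0)) (cst (ebase 1)) u by rewrite /nabla bracket0 scale0r.
  by rewrite nabla_dirZ ?scale0r.
rewrite subr0 !nabla_nabla_ebase //.
have [flatP flatQ] := flat Uu; have det0 := coef_det Uu.
have dP i j x : 'D_x (P i j) u = 'D_x ('D_(ebase i) (coef j 0)) u -
    (W i u * 'D_x (coef j 1) u + 'D_x (W i) u * coef j 1 u).
  by apply: derive_val; rewrite /P; derive_rules oU Uu.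
have dQ i j x : 'D_x (Q i j) u = 'D_x ('D_(ebase i) (coef j 1)) u +
    (W i u * 'D_x (coef j 0) u + 'D_x (W i) u * coef j 0 u).
  by apply: derive_val; rewrite /Q; derive_rules oU Uu.
have dW i x : 'D_x (W i) u = coef i 0 u * 'D_x (w 0) u + 'D_x (coef i 0) u * w 0 u
   + (coef i 1 u * 'D_x (w 1) u + 'D_x (coef i 1) u * w 1 u).
  by apply: derive_val; rewrite /W; derive_rules oU Uu.
have eE (i : 'I_2) : ebase i = coef i 0 u *: F 0 u + coef i 1 u *: F 1 u by exact: ebase_frame.
have innerEE i j : inner (g u) (ebase i) (ebase j) =
    coef i 0 u * coef j 0 u + coef i 1 u * coef j 1 u.
  by rewrite (eE i) (eE j) (inner_frame hF).
have sub (p q r s : R) : p *: F 0 u + q *: F 1 u - (r *: F 0 u + s *: F 1 u) =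
    (p - r) *: F 0 u + (q - s) *: F 1 u.
  by rewrite !scalerBl opprD addrACA.
rewrite sub (_ : inner (g u) _ (ebase 0) = ('D_(ebase 0) (P 1 1) u - W 0 u * Q 1 1 u
    - ('D_(ebase 1) (P 0 1) u - W 1 u * Q 0 1 u)) * coef 0 0 u
  + ('D_(ebase 0) (Q 1 1) u + W 0 u * P 1 1 u
    - ('D_(ebase 1) (Q 0 1) u + W 1 u * P 0 1 u)) * coef 0 1 u); last first.
  by rewrite [X in inner _ _ X](eE 0) (inner_frame hF).
rewrite !innerEE.
(* [refl] supplies the equations that hold by unfolding [W], [P] and [Q]. *)
have refl (x : R) : x = x by [].
exact: (@gauss_curvature_algebra R (coef 0 0 u) (coef 0 1 u) (coef 1 0 u) (coef 1 1 u)
  (w 0 u) (w 1 u) _ _ _ _ _ _ _ _ _ _ _ _ _ _ _ _ _ _ _ _ _ _ _ _ _ _ _ _ _ _ _ _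
  (refl (W 0 u)) (refl (W 1 u)) (dW 0 (ebase 1)) (dW 1 (ebase 0))
  (derive_ebase 0 (sw 0) Uu) (derive_ebase 0 (sw 1) Uu)
  (derive_ebase 1 (sw 0) Uu) (derive_ebase 1 (sw 1) Uu)
  (dP 1 1 (ebase 0)) (dP 0 1 (ebase 1)) (dQ 1 1 (ebase 0)) (dQ 0 1 (ebase 1))
  (schwarz 0 1 oU (scoef 1 0) Uu) (schwarz 0 1 oU (scoef 1 1) Uu)
  (refl (P 1 1 u)) (refl (P 0 1 u)) (refl (P 1 0 u))
  (refl (Q 1 1 u)) (refl (Q 0 1 u)) (refl (Q 1 0 u)) flatP flatQ det0).
Qed.

End gauss_curvature_frame.

(** * The frame (E1, E2, E3) of Sol_3 *)

Lemma ord3P (i : 'I_3) : [\/ i = 0, i = 1 | i = 2].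
Proof.
by case: i => [[|[|[|//]]] ?]; [apply: Or31|apply: Or32|apply: Or33]; exact: val_inj.
Qed.

(* E_a = exp (- sol_eps a * z) d_a for all three indices a. *)
Definition sol_eps {R : realType} (a : 'I_3) : R := [:: 1; -1; 0]`_a.

(* The coordinates of V at q in the orthonormal frame (E1, E2, E3). *)
Definition sol_coord {R : realType} (q V : 'rV[R]_3) (a : 'I_3) : R :=
  expR (sol_eps a * q 0 2) * V 0 a.

(* nabla_x y in the frame (E1, E2, E3), for x and y with constant coordinates. *)
Definition sol_gamma {R : realType} (x y : 'I_3 -> R) (a : 'I_3) : R :=
  sol_eps a * x a * y 2 - (a == 2)%:R * \sum_b sol_eps b * x b * y b.

Section sol.
Context {R : realType}.
Implicit Types (q V W : 'rV[R]_3).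

Lemma sol_metricE q i j :
  sol_metric q i j = (expR (sol_eps i * q 0 2)) ^+ 2 *+ (i == j).
Proof.
rewrite /sol_metric !mxE; congr (_ *+ _); rewrite expr2 -expRD /sol_eps.
case: (ord3P i) => -> /=; rewrite ?mul0r ?addr0 ?expR0 //; congr expR; ring.
Qed.

Lemma inner_sol q V W :
  inner (sol_metric q) V W = \sum_a sol_coord q V a * sol_coord q W a.
Proof.
rewrite innerE; apply: eq_bigr => a _.
rewrite (bigD1 a) //= big1 ?addr0 => [|b ba].
  by rewrite sol_metricE eqxx mulr1n /sol_coord; ring.
by rewrite sol_metricE eq_sym (negbTE ba) mulr0 mul0r.
Qed.

Lemma sol_coord_E1 q a : sol_coord q (E1 q) a = (a == 0)%:R.
Proof.
rewrite /sol_coord /E1 !mxE /= [a == 0]eq_sym; case: (ord3P a) => -> /=; rewrite ?mulr0 //.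
by rewrite mulr1 -expRD /sol_eps /= mul1r subrr expR0.
Qed.

Lemma sol_coord_E2 q a : sol_coord q (E2 q) a = (a == 1)%:R.
Proof.
rewrite /sol_coord /E2 !mxE /=; case: (ord3P a) => -> /=; rewrite ?mulr0 //.
by rewrite mulr1 -expRD /sol_eps /= mulN1r addNr expR0.
Qed.

Lemma sol_coord_E3 q a : sol_coord q (E3 q) a = (a == 2)%:R.
Proof.
rewrite /sol_coord /E3 !mxE /=; case: (ord3P a) => -> /=; rewrite ?mulr0 //.
by rewrite mulr1 /sol_eps /= mul0r expR0.
Qed.

Lemma derive_sol_metric q i j l :
  'D_(ebase i) (fun v => sol_metric v j l) q =
  (2 * sol_eps j * (expR (sol_eps j * q 0 2)) ^+ 2 * (i == 2)%:R) *+ (j == l).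
Proof.
pose z (v : 'rV[R]_3) : R := v 0 2.
have dz : differentiable z q by exact: differentiable_coord.
have -> : (fun v => sol_metric v j l) = fun v =>
    expR (sol_eps j * z v) * (expR (sol_eps j * z v) *+ (j == l)).
  by apply/funext => v; rewrite sol_metricE expr2 mulrnAr.
have ez : 'D_(ebase i) z q = (i == 2)%:R.
  rewrite derive_coord // (_ : (fun v : 'rV[R]_3 => v) = id) // derive_id mxE eqxx.
  by rewrite [2 == i]eq_sym.
have dl : differentiable (fun v => sol_eps j * z v) q.
  by apply: (@differentiableM _ _ (fun=> sol_eps j) z).
have de : is_derive q (ebase i) (fun v => expR (sol_eps j * z v))
    (expR (sol_eps j * z q) * (sol_eps j * (i == 2)%:R)).
  have -> : sol_eps j * (i == 2)%:R = 'D_(ebase i) (fun v => sol_eps j * z v) q.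
    by rewrite -ez; apply/esym/deriveMl/diff_derivable.
  exact: is_derive_exp.
case: (j == l) => /=; apply: derive_val; rewrite ?mulr1n ?mulr0n.
  rewrite (_ : 2 * _ * _ * _ = expR (sol_eps j * z q) * (expR (sol_eps j * z q) *
     (sol_eps j * (i == 2)%:R)) + expR (sol_eps j * z q) * (sol_eps j * (i == 2)%:R) *
     expR (sol_eps j * z q)); last by rewrite /z; ring.
  exact: is_derive_mul.
rewrite (_ : (fun _ => _) = fun=> 0); first exact: is_derive_const.
by apply/funext => v; rewrite mulr0.
Qed.

Lemma sol_metric_inv q k l :
  invmx (sol_metric q) k l = (expR (sol_eps k * q 0 2)) ^- 2 *+ (k == l).
Proof.
pose M : 'M[R]_3 := diag_mx (\row_k (expR (sol_eps k * q 0 2)) ^- 2).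
have E : sol_metric q *m M = 1%:M.
  have -> : sol_metric q = diag_mx (\row_k (expR (sol_eps k * q 0 2)) ^+ 2).
    by apply/matrixP => i j; rewrite sol_metricE !mxE.
  rewrite mulmx_diag -diag_const_mx; congr diag_mx; apply/rowP => i; rewrite !mxE.
  by rewrite mulfV // expf_neq0 // gt_eqF // expR_gt0.
have [u1 _] := mulmx1_unit E.
have -> : invmx (sol_metric q) = M by rewrite -[LHS]mulmx1 -E mulKmx.
by rewrite !mxE.
Qed.

Lemma christoffel_sol q k i j : christoffel sol_metric k i j q =
  sol_eps k * ((j == k)%:R * (i == 2)%:R + (i == k)%:R * (j == 2)%:R)
  - (i == j)%:R * (k == 2)%:R * sol_eps i * (expR (sol_eps i * q 0 2)) ^+ 2.
Proof.
rewrite /christoffel (bigD1 k) //= big1 ?addr0 => [|l lk]; last first.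
  by rewrite sol_metric_inv eq_sym (negbTE lk) mul0r.
rewrite sol_metric_inv eqxx mulr1n !derive_sol_metric.
have s0 : expR (sol_eps k * q 0 2) != 0 by rewrite gt_eqF // expR_gt0.
have move_index (f : 'I_3 -> R) a b : f a *+ (a == b) = f b * (a == b)%:R.
  by case: eqVneq => [->|_]; rewrite ?mulr1 ?mulr1n ?mulr0 ?mulr0n.
(* Since eps_2 = 0, the inverse metric entry is 1 at k = 2, the only index where the last term is
   nonzero. *)
have sk : (expR (sol_eps k * q 0 2)) ^- 2 * (k == 2)%:R = (k == 2)%:R.
  case: eqVneq => [->|_]; last by rewrite mulr0.
  by rewrite /sol_eps /= mul0r expR0 expr1n invr1 mulr1.
rewrite (move_index (fun j => 2 * sol_eps j * _ * _)).
rewrite (move_index (fun i => 2 * sol_eps i * _ * _)).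
rewrite -[X in _ - X]mulr_natr.
transitivity (sol_eps k * ((j == k)%:R * (i == 2)%:R + (i == k)%:R * (j == 2)%:R)
  - (i == j)%:R * ((expR (sol_eps k * q 0 2)) ^- 2 * (k == 2)%:R) * sol_eps i
    * (expR (sol_eps i * q 0 2)) ^+ 2); last by rewrite sk.
move: s0; move: (expR (sol_eps k * q 0 2)) (expR (sol_eps i * q 0 2)) => X Y X0.
move: (j == k)%:R (i == k)%:R (i == j)%:R (i == 2)%:R (j == 2)%:R (k == 2)%:R.
by move=> b1 b2 b3 b4 b5 b6; field.
Qed.

Lemma sum_christoffel_sol q (X V : 'rV[R]_3) k :
  \sum_i \sum_j christoffel sol_metric k i j q * X 0 i * V 0 j =
  sol_eps k * (X 0 2 * V 0 k + X 0 k * V 0 2)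
  - (k == 2)%:R * \sum_i sol_eps i * sol_coord q X i * sol_coord q V i.
Proof.
rewrite !sum3 !christoffel_sol /sol_coord.
move: (expR (sol_eps 0 * q 0 2)) (expR (sol_eps 1 * q 0 2)) (expR (sol_eps 2 * q 0 2)).
move=> e0 e1 e2; rewrite /sol_eps.
by case: (ord3P k) => -> /=; ring.
Qed.

(** Differentiating the factor exp (eps_a z) of the frame coordinate produces one of the two first
    terms of [sum_christoffel_sol]. What remains has constant coefficients and is [sol_gamma]. *)
Lemma nabla_along_sol m (psi V : 'rV[R]_m -> 'rV[R]_3) x u a :
  differentiable psi u -> differentiable V u ->
  sol_coord (psi u) (nabla_along sol_metric psi V x u) a =
  'D_x (fun v => sol_coord (psi v) (V v) a) u +
  sol_gamma (sol_coord (psi u) (x *m 'J psi u)) (sol_coord (psi u) (V u)) a.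
Proof.
move=> dpsi dV; pose z v := psi v 0 2.
have dc (f : 'rV[R]_m -> 'rV[R]_3) b : differentiable f u -> differentiable (fun v => f v 0 b) u.
  move=> df; apply: (@differentiable_comp _ _ _ _ f (fun M : 'rV[R]_3 => M 0 b)) => //.
  exact: differentiable_coord.
have dl : differentiable (fun v => sol_eps a * z v) u.
  by apply: (@differentiableM _ _ (fun=> sol_eps a) z) => //; exact: dc.
have xJ b : (x *m 'J psi u) 0 b = 'D_x (fun v => psi v 0 b) u.
  by rewrite -deriveEjacobian // derive_coord.
have H : 'D_x (fun v => sol_coord (psi v) (V v) a) u =
    expR (sol_eps a * z u) * 'D_x (fun v => V v 0 a) u +
    expR (sol_eps a * z u) * (sol_eps a * (x *m 'J psi u) 0 2) * V u 0 a.
  have -> : sol_eps a * (x *m 'J psi u) 0 2 = 'D_x (fun v => sol_eps a * z v) u.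
    by rewrite xJ; apply/esym/deriveMl/diff_derivable/dc.
  apply: derive_val; apply: (@is_derive_mul _ _ (fun v => expR (sol_eps a * z v))).
    exact: is_derive_exp.
  by apply/derivableP/diff_derivable/dc.
rewrite H {1}/sol_coord /nabla_along [_ 0 a]mxE [X in _ + X]mxE sum_christoffel_sol.
rewrite derive_coord // /sol_gamma.
move: (\sum_b _) => S; rewrite /sol_coord -/(z u).
move: (('D_x V u) 0 a) (x *m 'J psi u) (V u) => d y v.
have e2 : sol_eps 2 = 0 :> R by [].
by case: (eqVneq a 2) => [->|a2] /=; rewrite e2 !mul0r expR0; ring.
Qed.

End sol.

(** * Pointwise algebra of the structure equations *)

Definition dot3 {R : realType} (x y : 'I_3 -> R) : R := \sum_a x a * y a.

Definition orthonormal3 {R : realType} (t0 t1 n : 'I_3 -> R) : Prop :=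
  [/\ dot3 t0 t0 = 1, dot3 t1 t1 = 1 & dot3 n n = 1] /\
  [/\ dot3 t0 t1 = 0, dot3 t0 n = 0 & dot3 t1 n = 0].

Section algebra.
Context {R : realType}.
Implicit Types (x y z t n : 'I_3 -> R).

Lemma dot3C x y : dot3 x y = dot3 y x.
Proof. by apply: eq_bigr => a _; rewrite mulrC. Qed.

Lemma dot3D x y z : dot3 (fun a => x a + y a) z = dot3 x z + dot3 y z.
Proof. by rewrite /dot3 -big_split; apply: eq_bigr => a _; rewrite mulrDl. Qed.

(** The rows t0, t1, n form an orthogonal matrix, so its columns are orthonormal too. *)
Lemma orthonormal3_columns t0 t1 n a b : orthonormal3 t0 t1 n ->
  t0 a * t0 b + t1 a * t1 b + n a * n b = (a == b)%:R.
Proof.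
move=> [[t00 t11 nn] [t01 t0n t1n]].
pose M : 'M[R]_3 := \matrix_(i, a) nth n [:: t0; t1] i a.
have dotM i j : (M *m M^T) i j = dot3 (nth n [:: t0; t1] i) (nth n [:: t0; t1] j).
  by rewrite mxE; apply: eq_bigr => k _; rewrite !mxE.
have : M *m M^T = 1%:M.
  apply/matrixP => i j; rewrite dotM [RHS]mxE.
  by case: (ord3P i) => ->; case: (ord3P j) => -> /=; rewrite // dot3C.
move=> /mulmx1C /matrixP /(_ a b); rewrite !mxE sum3 !mxE /= => <-.
by [].
Qed.

Lemma orthonormal3_expand t0 t1 n x a : orthonormal3 t0 t1 n ->
  x a = dot3 x t0 * t0 a + dot3 x t1 * t1 a + dot3 x n * n a.
Proof.
move=> o; have E : \sum_b x b * (a == b)%:R = x a.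
  by rewrite (bigD1 a) //= eqxx mulr1 big1 ?addr0 // => b; rewrite eq_sym => /negbTE ->; rewrite mulr0.
rewrite -{1}E /dot3 !mulr_suml -!big_split; apply: eq_bigr => b _ /=.
by rewrite -(orthonormal3_columns a b o); ring.
Qed.

Lemma sol_gamma0 x y : sol_gamma x y 0 = x 0 * y 2.
Proof. by rewrite /sol_gamma /sol_eps /=; ring. Qed.

Lemma sol_gamma1 x y : sol_gamma x y 1 = - (x 1 * y 2).
Proof. by rewrite /sol_gamma /sol_eps /=; ring. Qed.

Lemma sol_gamma2 x y : sol_gamma x y 2 = x 1 * y 1 - x 0 * y 0.
Proof. by rewrite /sol_gamma sum3 /sol_eps /=; ring. Qed.

Lemma sol_gamma_skew x y z : dot3 (sol_gamma x y) z + dot3 (sol_gamma x z) y = 0.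
Proof. by rewrite /dot3 !sum3 !sol_gamma0 !sol_gamma1 !sol_gamma2; ring. Qed.

Lemma weingarten_algebra t0 t1 n x : orthonormal3 t0 t1 n -> dot3 x n = 0 ->
  forall a, x a = dot3 x t0 * t0 a + dot3 x t1 * t1 a.
Proof. by move=> o xn a; rewrite {1}(orthonormal3_expand x a o) xn mul0r addr0. Qed.

Lemma half_sum (p q : R) : p + p = 0 -> q + q = 0 -> p + q = 0.
Proof. by move=> H1 H2; lra. Qed.

(** The multipliers a, b, c are chosen by the caller; [ring] then checks that x - y is that
    combination of the three residuals. *)
Let combine3 (l0 r0 l1 r1 l2 r2 : R) : l0 = r0 -> l1 = r1 -> l2 = r2 ->
  forall a b c x y : R, x - y = a * (r0 - l0) + b * (r1 - l1) + c * (r2 - l2) -> x = y.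
Proof. by move=> -> -> -> a b c x y; rewrite !subrr !mulr0 !addr0 => /subr0_eq. Qed.

Let lin_half (p : R) : p + p = 0 -> p = 0.
Proof. by move=> H; lra. Qed.

(** * The Gauss formula as linear algebra in R^3 *)

Section gauss_formula.
(** [dij] is the derivative along F_i of the coordinates of F_j, and [dni] that of the normal. The
    hypotheses [s...] are the differentiated orthonormality relations. *)
Variables (t0 t1 n d00 d01 d10 d11 dn0 dn1 : 'I_3 -> R) (h00 h01 h10 h11 w0 w1 : R).
Hypothesis o : orthonormal3 t0 t1 n.
Hypothesis s000 : dot3 d00 t0 + dot3 d00 t0 = 0.
Hypothesis s001 : dot3 d00 t1 + dot3 d01 t0 = 0.
Hypothesis s011 : dot3 d01 t1 + dot3 d01 t1 = 0.
Hypothesis s100 : dot3 d10 t0 + dot3 d10 t0 = 0.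
Hypothesis s101 : dot3 d10 t1 + dot3 d11 t0 = 0.
Hypothesis s111 : dot3 d11 t1 + dot3 d11 t1 = 0.
Hypothesis s00n : dot3 d00 n + dot3 dn0 t0 = 0.
Hypothesis s01n : dot3 d01 n + dot3 dn0 t1 = 0.
Hypothesis s10n : dot3 d10 n + dot3 dn1 t0 = 0.
Hypothesis s11n : dot3 d11 n + dot3 dn1 t1 = 0.
Hypothesis wein0 : forall a, dn0 a + sol_gamma t0 n a = - h00 * t0 a + - h01 * t1 a.
Hypothesis wein1 : forall a, dn1 a + sol_gamma t1 n a = - h10 * t0 a + - h11 * t1 a.
Hypothesis tor : forall a, d01 a + sol_gamma t0 t1 a =
  d10 a + sol_gamma t1 t0 a + - w0 * t0 a + - w1 * t1 a.

Let cov (d x y : 'I_3 -> R) := fun a => d a + sol_gamma x y a.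

Let dot_cov d x y z : dot3 (cov d x y) z = dot3 d z + dot3 (sol_gamma x y) z.
Proof. exact: dot3D. Qed.

Let dot_comb (p q : R) z (u := fun a => p * t0 a + q * t1 a) :
  dot3 u z = p * dot3 t0 z + q * dot3 t1 z.
Proof. by rewrite /dot3 !sum3 /u; ring. Qed.

Let dot_dn (dn x : 'I_3 -> R) (p q : R) z :
  (forall a, dn a + sol_gamma x n a = p * t0 a + q * t1 a) ->
  dot3 dn z + dot3 (sol_gamma x n) z = p * dot3 t0 z + q * dot3 t1 z.
Proof.
move=> H; rewrite -dot3D -dot_comb; apply: eq_bigr => a _; by rewrite H.
Qed.

Let tor_dot z : dot3 (cov d01 t0 t1) z =
  dot3 (cov d10 t1 t0) z + - w0 * dot3 t0 z + - w1 * dot3 t1 z.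
Proof.
rewrite -addrA -dot_comb -dot3D; apply: eq_bigr => a _; by rewrite /cov tor !addrA.
Qed.

(** Each covariant derivative is recovered from its three dot products. The normal ones come from
    the Weingarten equations. Unit length kills four tangential ones; the other four follow from two
    skewness relations and the two tangential components of the torsion equation, whose normal
    component is the symmetry of h. *)
Lemma gauss_formula_algebra :
  [/\ h01 = h10,
      forall a, d00 a = h00 * n a + w0 * t1 a - sol_gamma t0 t0 a,
      forall a, d01 a = h01 * n a - w0 * t0 a - sol_gamma t0 t1 a,
      forall a, d10 a = h01 * n a + w1 * t1 a - sol_gamma t1 t0 a &
      forall a, d11 a = h11 * n a - w1 * t0 a - sol_gamma t1 t1 a].
Proof.
have [[t00 t11 nn] [t01 t0n t1n]] := o; have t10 : dot3 t1 t0 = 0 by rewrite dot3C.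
have E00n : dot3 (cov d00 t0 t0) n = h00.
  have := dot_dn t0 wein0; have := sol_gamma_skew t0 t0 n; rewrite dot_cov t00 t10.
  by move: s00n => s H1 H2; lra.
have E01n : dot3 (cov d01 t0 t1) n = h01.
  have := dot_dn t1 wein0; have := sol_gamma_skew t0 t1 n; rewrite dot_cov t01 t11.
  by move: s01n => s H1 H2; lra.
have E10n : dot3 (cov d10 t1 t0) n = h10.
  have := dot_dn t0 wein1; have := sol_gamma_skew t1 t0 n; rewrite dot_cov t00 t10.
  by move: s10n => s H1 H2; lra.
have E11n : dot3 (cov d11 t1 t1) n = h11.
  have := dot_dn t1 wein1; have := sol_gamma_skew t1 t1 n; rewrite dot_cov t01 t11.
  by move: s11n => s H1 H2; lra.
have hs : h01 = h10.
  by have := tor_dot n; rewrite E01n E10n t0n t1n => ->; ring.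
have E000 : dot3 (cov d00 t0 t0) t0 = 0.
  have := sol_gamma_skew t0 t0 t0; rewrite dot_cov => /lin_half ->; rewrite addr0.
  exact: lin_half.
have E011 : dot3 (cov d01 t0 t1) t1 = 0.
  have := sol_gamma_skew t0 t1 t1; rewrite dot_cov => /lin_half ->; rewrite addr0.
  exact: lin_half.
have E100 : dot3 (cov d10 t1 t0) t0 = 0.
  have := sol_gamma_skew t1 t0 t0; rewrite dot_cov => /lin_half ->; rewrite addr0.
  exact: lin_half.
have E111 : dot3 (cov d11 t1 t1) t1 = 0.
  have := sol_gamma_skew t1 t1 t1; rewrite dot_cov => /lin_half ->; rewrite addr0.
  exact: lin_half.
have E010 : dot3 (cov d01 t0 t1) t0 = - w0.
  by rewrite tor_dot E100 t00 t10; ring.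
have E101 : dot3 (cov d10 t1 t0) t1 = w1.
  have := tor_dot t1; rewrite E011 t01 t11 => H; lra.
have E001 : dot3 (cov d00 t0 t0) t1 = w0.
  have := sol_gamma_skew t0 t0 t1; move: E010; rewrite !dot_cov.
  by move: s001 => s H1 H2; lra.
have E110 : dot3 (cov d11 t1 t1) t0 = - w1.
  have := sol_gamma_skew t1 t0 t1; move: E101; rewrite !dot_cov.
  by move: s101 => s H1 H2; lra.
split=> // a.
- have := orthonormal3_expand (cov d00 t0 t0) a o; rewrite E000 E001 E00n /cov => H; lra.
- have := orthonormal3_expand (cov d01 t0 t1) a o; rewrite E010 E011 E01n /cov => H; lra.
- have := orthonormal3_expand (cov d10 t1 t0) a o; rewrite E100 E101 E10n /cov hs => H; lra.
- have := orthonormal3_expand (cov d11 t1 t1) a o; rewrite E110 E111 E11n /cov => H; lra.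
Qed.

End gauss_formula.

(** * The Codazzi and Simons identities as polynomial identities *)

Let area (x y : 'I_3 -> R) : R := x 0 * y 1 - x 1 * y 0.

Let cross (x y : 'I_3 -> R) (a : 'I_3) : R :=
  [:: x 1 * y 2 - x 2 * y 1; x 2 * y 0 - x 0 * y 2; area x y]`_a.

(* The rows t0, t1, n form an orthogonal matrix, so cofactors equal entries up
   to its determinant d; d is unknown, but d ^ 2 = 1. *)
Lemma cofactor_products t0 t1 n : orthonormal3 t0 t1 n ->
  area t0 t1 * area t0 n = - (n 2 * t1 2) /\ area t0 t1 * area t1 n = n 2 * t0 2.
Proof.
move=> o; have [[t00 t11 nn] [t01 t0n t1n]] := o.
pose d := dot3 (cross t0 t1) n.
have crossE x y : [/\ cross x y 0 = x 1 * y 2 - x 2 * y 1,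
    cross x y 1 = x 2 * y 0 - x 0 * y 2 & cross x y 2 = area x y] by [].
have dotcross x y z : dot3 (cross x y) z =
  (x 1 * y 2 - x 2 * y 1) * z 0 + (x 2 * y 0 - x 0 * y 2) * z 1 + (x 0 * y 1 - x 1 * y 0) * z 2.
  by rewrite /dot3 sum3; have [-> -> ->] := crossE x y.
have cl x y : dot3 (cross x y) x = 0 by rewrite dotcross; ring.
have cr x y : dot3 (cross x y) y = 0 by rewrite dotcross; ring.
have ct a : cross t0 t1 a = d * n a.
  by rewrite (orthonormal3_expand (cross t0 t1) a o) cl cr !mul0r !add0r.
have En : area t0 t1 = d * n 2 by exact: (ct 2).
have E0 : area t1 n = d * t0 2.
  have -> : area t1 n = cross t1 n 2 by [].
  rewrite (orthonormal3_expand (cross t1 n) 2 o) cl cr !mul0r !addr0.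
  by congr (_ * _); rewrite /d !dotcross; ring.
have E1 : area t0 n = - (d * t1 2).
  have -> : area t0 n = cross t0 n 2 by [].
  rewrite (orthonormal3_expand (cross t0 n) 2 o) cl cr !mul0r add0r addr0 -mulNr.
  by congr (_ * _); rewrite /d !dotcross; ring.
have dd : d ^+ 2 = 1.
  transitivity (dot3 (cross t0 t1) (cross t0 t1)).
    rewrite -[LHS]mulr1 -nn /dot3 mulr_sumr; apply: eq_bigr => a _.
    by rewrite ct; ring.
  transitivity (dot3 t0 t0 * dot3 t1 t1 - dot3 t0 t1 ^+ 2); last by rewrite t00 t11 t01; ring.
  rewrite dotcross; have [-> -> ->] := crossE t0 t1; rewrite /dot3 !sum3 /area; ring.
by rewrite En E0 E1; split; rewrite -[RHS]mul1r -dd; ring.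
Qed.

(* k followed by l, i, j is the derivative of h_ij along F_l; the last hypothesis
   is the commutation of the frame derivatives of n. *)
Lemma codazzi_algebra t0 t1 n (d00 d01 d10 d11 dn0 dn1 : 'I_3 -> R)
    (h00 h01 h11 w0 w1 k001 k011 k100 k101 : R) :
  orthonormal3 t0 t1 n ->
  (forall a, dn0 a = - h00 * t0 a + - h01 * t1 a - sol_gamma t0 n a) ->
  (forall a, dn1 a = - h01 * t0 a + - h11 * t1 a - sol_gamma t1 n a) ->
  (forall a, d00 a = h00 * n a + w0 * t1 a - sol_gamma t0 t0 a) ->
  (forall a, d01 a = h01 * n a - w0 * t0 a - sol_gamma t0 t1 a) ->
  (forall a, d10 a = h01 * n a + w1 * t1 a - sol_gamma t1 t0 a) ->
  (forall a, d11 a = h11 * n a - w1 * t0 a - sol_gamma t1 t1 a) ->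
  (forall a, - (h01 * d00 a + k001 * t0 a) - (h11 * d01 a + k011 * t1 a)
      - (sol_gamma t1 dn0 a + sol_gamma d01 n a) =
    - (h00 * d10 a + k100 * t0 a) - (h01 * d11 a + k101 * t1 a)
      - (sol_gamma t0 dn1 a + sol_gamma d10 n a) - w0 * dn0 a - w1 * dn1 a) ->
  k001 - w0 * h11 + w0 * h00 - (k100 - 2 * w1 * h01) = 2 * n 2 * t1 2 /\
  k011 + 2 * w0 * h01 - (k101 - w1 * h11 + w1 * h00) = - (2 * n 2 * t0 2).
Proof.
move=> o En0 En1 E00 E01 E10 E11 H.
have [[t00 t11 nn] [t01 t0n t1n]] := o; have [A0 A1] := cofactor_products o.
have := H 2; have := H 1; have := H 0.
rewrite !sol_gamma0 !sol_gamma1 !sol_gamma2 !En0 !En1 !E00 !E01 !E10 !E11.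
rewrite !sol_gamma0 !sol_gamma1 !sol_gamma2.
move: A0 A1 t00 t11 t01 t0n t1n; rewrite /dot3 !sum3 /area.
move: (t0 0) (t0 1) (t0 2) (t1 0) (t1 1) (t1 2) (n 0) (n 1) (n 2).
move=> p0 p1 p2 q0 q1 q2 m0 m1 m2 A0 A1 t00 t11 t01 t0n t1n.
set X0 := k001 - _ + _ - _; set X1 := k011 + _ - _.
move=> H0 H1 H2; have {H0 H1 H2}comb := combine3 H0 H1 H2.
(* Pairing the three coordinate equations with t0, and below with t1, isolates X0 and X1. The inner
   products and areas stay visible so that orthonormality and [cofactor_products] can be rewritten
   afterwards. *)
have e0 : X0 * (p0 * p0 + p1 * p1 + p2 * p2) + X1 * (p0 * q0 + p1 * q1 + p2 * q2) =
    (q0 * m0 + q1 * m1 + q2 * m2) * (p0 * p0 + p1 * p1 + p2 * p2)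
    - (p0 * m0 + p1 * m1 + p2 * m2) * (p0 * q0 + p1 * q1 + p2 * q2)
    - 2 * ((p0 * q1 - p1 * q0) * (p0 * m1 - p1 * m0)).
  by apply: (comb p0 p1 p2); rewrite /X0 /X1; ring.
have e1 : X0 * (p0 * q0 + p1 * q1 + p2 * q2) + X1 * (q0 * q0 + q1 * q1 + q2 * q2) =
    (q0 * m0 + q1 * m1 + q2 * m2) * (p0 * q0 + p1 * q1 + p2 * q2)
    - (p0 * m0 + p1 * m1 + p2 * m2) * (q0 * q0 + q1 * q1 + q2 * q2)
    - 2 * ((p0 * q1 - p1 * q0) * (q0 * m1 - q1 * m0)).
  by apply: (comb q0 q1 q2); rewrite /X0 /X1; ring.
move: e0 e1; rewrite t00 t11 t01 t0n t1n A0 A1 => e0 e1.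
split; [transitivity (X0 * 1 + X1 * 0)|transitivity (X0 * 0 + X1 * 1)].
- by ring.
- by rewrite e0; ring.
- by ring.
- by rewrite e1; ring.
Qed.

(* p, q, m are the coordinates of F0, F1 and the normal in (E1, E2, E3); c_ijl is
   the covariant derivative (nabla_l h)_ij, k_ijl the plain derivative of h_ij
   along F_l, e_ijlr the derivative of c_ijl along F_r, and w_ij that of w_j
   along F_i.  The Codazzi equations and the commutators eliminate all second
   derivatives but five; what remains is a combination of the column relations
   col00, col11, col02 and col12. *)
Lemma simons_algebra
    (p0 p1 p2 q0 q1 q2 m0 m1 m2 h00 h01 h11 w0 w1 w01 w10
     c000 c001 c010 c011 c110 c111
     k000 k001 k010 k011 k110 k111
     e0000 e0001 e0010 e0011 e0100 e0101 e0110 e0111 e1100 e1101 e1110 e1111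
     dp02 dp12 dq02 dq12 dm02 dm12 K : R) :
  p0 * p0 + q0 * q0 + m0 * m0 = 1 -> p1 * p1 + q1 * q1 + m1 * m1 = 1 ->
  p0 * p2 + q0 * q2 + m0 * m2 = 0 -> p1 * p2 + q1 * q2 + m1 * m2 = 0 ->
  dm02 = - h00 * p2 + - h01 * q2 - (p1 * m1 - p0 * m0) ->
  dm12 = - h01 * p2 + - h11 * q2 - (q1 * m1 - q0 * m0) ->
  dp02 = h00 * m2 + w0 * q2 - (p1 * p1 - p0 * p0) ->
  dq02 = h01 * m2 - w0 * p2 - (p1 * q1 - p0 * q0) ->
  dp12 = h01 * m2 + w1 * q2 - (q1 * p1 - q0 * p0) ->
  dq12 = h11 * m2 - w1 * p2 - (q1 * q1 - q0 * q0) ->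
  k000 = c000 + 2 * w0 * h01 -> k001 = c001 + 2 * w1 * h01 ->
  k010 = c010 + w0 * (h11 - h00) -> k011 = c011 + w1 * (h11 - h00) ->
  k110 = c110 - 2 * w0 * h01 -> k111 = c111 - 2 * w1 * h01 ->
  c010 = c001 + 2 * m2 * q2 -> c011 = c110 + 2 * m2 * p2 ->
  e0100 = e0010 + (2 * m2 * dq02 + 2 * dm02 * q2) ->
  e0101 = e0011 + (2 * m2 * dq12 + 2 * dm12 * q2) ->
  e0110 = e1100 + (2 * m2 * dp02 + 2 * dm02 * p2) ->
  e0111 = e1101 + (2 * m2 * dp12 + 2 * dm12 * p2) ->
  e0010 + (2 * w1 * k010 + 2 * w01 * h01) =
    e0001 + (2 * w0 * k011 + 2 * w10 * h01) - w0 * k000 - w1 * k001 ->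
  e1110 - (2 * w1 * k010 + 2 * w01 * h01) =
    e1101 - (2 * w0 * k011 + 2 * w10 * h01) - w0 * k110 - w1 * k111 ->
  e0110 + (w1 * (k110 - k000) + w01 * (h11 - h00)) =
    e0101 + (w0 * (k111 - k001) + w10 * (h11 - h00)) - w0 * k010 - w1 * k011 ->
  K = - (w01 - w10 + w0 ^+ 2 + w1 ^+ 2) ->
  let f := 2^-1 * (h00 + h11) in
  let f0 := 2^-1 * (c000 + c110) in let f1 := 2^-1 * (c001 + c111) in
  let A2 := h00 * h00 + 2 * (h01 * h01) + h11 * h11 in
  let Q (x0 x1 y0 y1 : R) := (x0 * h00 + x1 * h01) * y0 + (x0 * h01 + x1 * h11) * y1 in
  2^-1 * (2 * (h00 * e0000 + k000 * c000 + 2 * (h01 * e0100 + k010 * c010)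
               + (h11 * e1100 + k110 * c110))
        + 2 * (h00 * e0011 + k001 * c001 + 2 * (h01 * e0111 + k011 * c011)
               + (h11 * e1111 + k111 * c111))
        + 2 * (h00 * c000 + 2 * (h01 * c010) + h11 * c110) * w1
        - 2 * (h00 * c001 + 2 * (h01 * c011) + h11 * c111) * w0) =
  c000 * c000 + c010 * c010 + (c010 * c010 + c110 * c110)
  + (c001 * c001 + c011 * c011 + (c011 * c011 + c111 * c111))
  + 2 * (f0 * k000 + 2^-1 * (e0000 + e1100) * h00 + (f1 * k010 + 2^-1 * (e0010 + e1110) * h01)
         + (f0 * k011 + 2^-1 * (e0001 + e1101) * h01 + (f1 * k111 + 2^-1 * (e0011 + e1111) * h11))
         + (f0 * h00 + f1 * h01) * w1 - (f0 * h01 + f1 * h11) * w0)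
  - 4 * (f0 * f0 + f1 * f1)
  - 4 * m2 * (f0 * p2 + f1 * q2)
  + 2 * K * (A2 - 2 * f ^+ 2)
  + 4 * m2 ^+ 2 * (A2 - 2 * f ^+ 2)
  - 8 * f * m2 * (m1 ^+ 2 - m0 ^+ 2)
  + 4 * f * Q p2 q2 p2 q2
  + 4 * m2 * Q p0 q0 p0 q0
  - 4 * m2 * Q p1 q1 p1 q1
  + 4 * m0 * Q p2 q2 p0 q0
  - 4 * m1 * Q p2 q2 p1 q1
  - 4 * ((p2 * h00 + q2 * h01) * (p2 * h00 + q2 * h01)
         + (p2 * h01 + q2 * h11) * (p2 * h01 + q2 * h11)).
Proof.
move=> col00 col11 col02 col12 -> -> -> -> -> -> -> -> -> -> -> -> -> -> -> -> -> ->.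
(* The three commutators are solved for [e0010], [e1110] and [e1100]; in the third, the Codazzi
   substitutions have already replaced [e0110] and [e0101]. *)
move=> /(canRL (addrK _)) -> /(canRL (subrK _)) -> /(canRL (addrK _)) C -> f f0 f1 A2 Q.
have {C} -> : e1100 = e0011
   + (2 * m2 * (h11 * m2 - w1 * p2 - (q1 * q1 - q0 * q0))
      + 2 * (- h01 * p2 + - h11 * q2 - (q1 * m1 - q0 * m0)) * q2)
   + (w0 * (c111 - 2 * w1 * h01 - (c001 + 2 * w1 * h01)) + w10 * (h11 - h00))
   - w0 * (c001 + 2 * m2 * q2 + w0 * (h11 - h00))
   - w1 * (c110 + 2 * m2 * p2 + w1 * (h11 - h00))
   - (w1 * (c110 - 2 * w0 * h01 - (c000 + 2 * w0 * h01)) + w01 * (h11 - h00))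
   - (2 * m2 * (h00 * m2 + w0 * q2 - (p1 * p1 - p0 * p0))
      + 2 * (- h00 * p2 + - h01 * q2 - (p1 * m1 - p0 * m0)) * p2).
  by apply: (addIr (2 * m2 * (h00 * m2 + w0 * q2 - (p1 * p1 - p0 * p0))
      + 2 * (- h00 * p2 + - h01 * q2 - (p1 * m1 - p0 * m0)) * p2)); rewrite C; ring.
apply/eqP; rewrite eq_sym -subr_eq0; apply/eqP.
(* The right side minus the left is 4 f times a combination of the column relations with multipliers
   m0, m2, - m1, - m2. *)
transitivity (2 * (h00 + h11) * (
    m0 * (p0 * p2 + q0 * q2 + m0 * m2) + m2 * (p0 * p0 + q0 * q0 + m0 * m0 - 1)
    - m1 * (p1 * p2 + q1 * q2 + m1 * m2) - m2 * (p1 * p1 + q1 * q1 + m1 * m1 - 1))).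
  by rewrite /Q /A2 /f /f0 /f1; field.
by rewrite col00 col11 col02 col12; ring.
Qed.

End algebra.

(** * Surfaces in Sol_3 *)

Lemma is_derive_gamma {R : realType} {m : nat} (x y : 'I_3 -> 'rV[R]_m -> R)
    (dx dy : 'I_3 -> R) u e a :
  (forall b, is_derive u e (x b) (dx b)) -> (forall b, is_derive u e (y b) (dy b)) ->
  is_derive u e (fun v => sol_gamma (x^~ v) (y^~ v) a)
    (sol_gamma (x^~ u) dy a + sol_gamma dx (y^~ u) a).
Proof.
move=> hx hy.
have -> : sol_gamma (x^~ u) dy a + sol_gamma dx (y^~ u) a =
    (sol_eps a * x a u * dy 2 + sol_eps a * dx a * y 2 u) +
    - ((a == 2)%:R * \sum_b (sol_eps b * x b u * dy b + sol_eps b * dx b * y b u)).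
  by rewrite /sol_gamma !sum3; ring.
apply: is_derive_add; last (apply: is_derive_opp; apply: is_derive_scale;
  apply: is_derive_bigsum => b); apply: is_derive_mul => //; exact: is_derive_scale.
Qed.

Definition frame_coord {R : realType} (psi : 'rV[R]_2 -> 'rV[R]_3)
  (F : 'I_2 -> 'rV[R]_2 -> 'rV[R]_2) (i : 'I_2) (a : 'I_3) (v : 'rV[R]_2) : R :=
  sol_coord (psi v) (F i v *m 'J psi v) a.

Definition normal_coord {R : realType} (psi nu : 'rV[R]_2 -> 'rV[R]_3) (a : 'I_3)
  (v : 'rV[R]_2) : R := sol_coord (psi v) (nu v) a.

Definition second_form {R : realType} (g : 'rV[R]_2 -> 'M[R]_2)
  (psi nu : 'rV[R]_2 -> 'rV[R]_3) (F : 'I_2 -> 'rV[R]_2 -> 'rV[R]_2)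
  (i j : 'I_2) (v : 'rV[R]_2) : R :=
  inner (g v) (F i v *m shape_operator g psi nu v) (F j v).

(** E is exp (eps_a z), s and t are the derivatives of the a-th coordinate of psi along F0 and F1,
    and p, q are the derivatives of the frame coordinates of F1 along F0 and of F0 along F1. The sum
    inside [sol_gamma] is symmetric, so it cancels. *)
Lemma torsion_algebra {R : realType} (a : 'I_3) (x y : 'I_3 -> R) (e E d01 d10 w0 w1 p q s t : R) :
  e = sol_eps a -> p = E * d01 + E * (e * x 2) * t -> q = E * d10 + E * (e * y 2) * s ->
  d01 = d10 - w0 * s - w1 * t -> x a = E * s -> y a = E * t ->
  p + sol_gamma x y a = q + sol_gamma y x a + - w0 * x a + - w1 * y a.
Proof.
move=> -> -> -> -> xa ya; rewrite /sol_gamma xa ya.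
have -> : \sum_b sol_eps b * y b * x b = \sum_b sol_eps b * x b * y b.
  by apply: eq_bigr => b _; ring.
by move: (\sum_b _) => S; ring.
Qed.

Section surface.
Context {R : realType}.
Variables (g : 'rV[R]_2 -> 'M[R]_2) (U : set 'rV[R]_2).
Variables (psi nu : 'rV[R]_2 -> 'rV[R]_3) (F : 'I_2 -> 'rV[R]_2 -> 'rV[R]_2).
Hypothesis oU : open U.
Hypothesis sg : smooth_on U g.
Hypothesis gsym : forall v, U v -> (g v)^T = g v.
Hypothesis hF : orthonormal_frame_on g U F.
Hypothesis spsi : smooth_on U psi.
Hypothesis snu : smooth_on U nu.
Hypothesis gpsi : forall v, U v ->
  g v = 'J psi v *m sol_metric (psi v) *m ('J psi v)^T.
Hypothesis nu_unit : forall v, U v -> inner (sol_metric (psi v)) (nu v) (nu v) = 1.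
Hypothesis nu_normal : forall v, U v -> forall X : 'rV[R]_2,
  inner (sol_metric (psi v)) (nu v) (X *m 'J psi v) = 0.

Local Notation D := (frame_derive F).
Local Notation w := (frame_form g F).
Local Notation T := (frame_coord psi F).
Local Notation N := (normal_coord psi nu).
Local Notation h := (second_form g psi nu F).
Local Notation A := (shape_operator g psi nu).
Local Notation Tv i v := (fun a => T i a v).
Local Notation Nv v := (fun a => N a v).

Let sD i k : smooth_on U k -> smooth_on U (D i k).
Proof. exact: (smooth_frame_derive oU hF). Qed.

Let sw i : smooth_on U (w i).
Proof. exact: smooth_frame_form. Qed.

Let spsic a : smooth_on U (fun v => psi v 0 a).
Proof. exact: smooth_coord. Qed.

Lemma inner_tangent_part V Y v : U v ->
  inner (g v) (tangent_part g psi V v) Y = inner (sol_metric (psi v)) V (Y *m 'J psi v).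
Proof.
move=> Uv; rewrite /inner /tangent_part mulmxKV ?(frame_metric_unit hF) //.
by rewrite trmx_mul !mulmxA.
Qed.

Lemma inner_normal_part V v : U v ->
  inner (sol_metric (psi v)) (nu v) (normal_part g psi V v) =
  inner (sol_metric (psi v)) (nu v) V.
Proof.
move=> Uv; rewrite /normal_part -scaleN1r innerDr innerZr nu_normal //.
by rewrite mulr0 addr0.
Qed.

(** The matrix is defined by its rows on coordinate fields; [nabla_along] is linear in the
    direction. *)
Lemma shape_operator_app X v : U v ->
  X *m A v = tangent_part g psi (- nabla_along sol_metric psi nu X v) v.
Proof.
move=> Uv; have dnu := smooth_differentiable snu Uv.
have lin : nabla_along sol_metric psi nu X v =
    X 0 0 *: nabla_along sol_metric psi nu (ebase 0) v +
    X 0 1 *: nabla_along sol_metric psi nu (ebase 1) v.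
  have EX : X = X 0 0 *: ebase 0 + X 0 1 *: ebase 1 by rewrite {1}[X]row_sum_delta sum2.
  rewrite {1}EX /nabla_along derive_dirD // !derive_dirZ // !scalerDr addrACA.
  congr (_ + _); apply/rowP => k; rewrite mulmxDl -!scalemxAl !mxE !mulr_sumr -big_split.
  apply: eq_bigr => a _ /=; rewrite !mulr_sumr -big_split; apply: eq_bigr => b _ /=.
  by rewrite !mxE; ring.
rewrite mulmx_sum_row sum2 !rowK lin /tangent_part.
move: (nabla_along _ _ _ (ebase 0) v) (nabla_along _ _ _ (ebase 1) v) => n0 n1.
rewrite opprD -!scalerN.
by rewrite !mulmxDl -!scalemxAl.
Qed.

Lemma frame_coordE i a v : U v ->
  T i a v = expR (sol_eps a * psi v 0 2) * D i (fun v => psi v 0 a) v.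
Proof.
move=> Uv; have dpsi := smooth_differentiable spsi Uv.
by rewrite /frame_coord /sol_coord -deriveEjacobian // /frame_derive derive_coord.
Qed.

Lemma smooth_frame_coord i a : smooth_on U (T i a).
Proof.
apply: (@smooth_on_eq _ _ _ _
  (fun v => expR (sol_eps a * psi v 0 2) * D i (fun v => psi v 0 a) v)) => //.
  by move=> v Uv; rewrite frame_coordE.
have := sD i (spsic a); move=> ?; smooth oU.
Qed.

Lemma smooth_normal_coord a : smooth_on U (N a).
Proof.
have := smooth_coord 0 a oU snu; move=> ?; rewrite /normal_coord /sol_coord; smooth oU.
Qed.

Lemma orthonormal_coord v : U v -> orthonormal3 (Tv 0 v) (Tv 1 v) (Nv v).
Proof.
move=> Uv.
have TT i j : dot3 (Tv i v) (Tv j v) = (i == j)%:R.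
  have [_ /(_ v Uv i j) <-] := hF.
  by rewrite [LHS](esym (inner_sol _ _ _)) gpsi // /inner trmx_mul !mulmxA.
have TN i : dot3 (Tv i v) (Nv v) = 0.
  by rewrite dot3C [LHS](esym (inner_sol _ _ _)) nu_normal.
have NN : dot3 (Nv v) (Nv v) = 1.
  by rewrite [LHS](esym (inner_sol _ _ _)) nu_unit.
by split; split; rewrite ?TT ?TN ?NN.
Qed.

Lemma dot3_const_derive (x y : 'I_3 -> 'rV[R]_2 -> R) (c : R) i u :
  (forall a, smooth_on U (x a)) -> (forall a, smooth_on U (y a)) ->
  (forall v, U v -> dot3 (x^~ v) (y^~ v) = c) -> U u ->
  dot3 (fun a => D i (x a) u) (y^~ u) + dot3 (fun a => D i (y a) u) (x^~ u) = 0.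
Proof.
move=> sx sy xy Uu; rewrite [X in _ + X]dot3C -big_split /=.
apply: (@is_derive_uniq _ _ _ (fun v => dot3 (x^~ v) (y^~ v)) (fun=> c) u (F i u)
  _ _ oU Uu xy) (is_derive_const c u (F i u)).
by apply: is_derive_bigsum => a; rewrite addrC; derive_rules oU Uu.
Qed.

(** This is [frame_commute] for the coordinate functions of psi, rewritten in the frame (E1, E2,
    E3). *)
Lemma frame_coord_torsion a u : U u ->
  D 0 (T 1 a) u + sol_gamma (Tv 0 u) (Tv 1 u) a =
  D 1 (T 0 a) u + sol_gamma (Tv 1 u) (Tv 0 u) a
  + - w 0 u * T 0 a u + - w 1 u * T 1 a u.
Proof.
move=> Uu.
have T2 i : T i 2 u = D i (fun v => psi v 0 2) u.
  by rewrite frame_coordE // /sol_eps /= mul0r expR0 mul1r.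
have dT i j : D i (T j a) u =
   expR (sol_eps a * psi u 0 2) * D i (D j (fun v => psi v 0 a)) u +
   expR (sol_eps a * psi u 0 2) * (sol_eps a * T i 2 u) * D j (fun v => psi v 0 a) u.
  rewrite T2 /frame_derive (open_derive_eq _ oU Uu (fun v Uv => frame_coordE j a Uv)).
  apply: derive_val; apply: is_derive_mul.
    have <- : 'D_(F i u) (fun v => sol_eps a * psi v 0 2) u =
      sol_eps a * 'D_(F i u) (fun v => psi v 0 2) u.
      apply: derive_val; derive_rules oU Uu.
    by apply: is_derive_exp; apply: smooth_differentiable Uu; smooth oU.
  by apply: smooth_is_derive Uu; exact: sD.
exact: (torsion_algebra (erefl _) (dT 0 1) (dT 1 0)
  (frame_commute oU sg gsym hF (spsic a) Uu) (frame_coordE 0 a Uu) (frame_coordE 1 a Uu)).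
Qed.

Lemma second_form_coord i j v : U v ->
  h i j v = - dot3 (fun a => D i (N a) v + sol_gamma (Tv i v) (Nv v) a) (Tv j v).
Proof.
move=> Uv; rewrite /second_form shape_operator_app // inner_tangent_part //.
rewrite -scaleN1r innerZl mulN1r inner_sol; congr (- _); apply: eq_bigr => a _.
by rewrite nabla_along_sol //; exact: smooth_differentiable Uv.
Qed.

Lemma smooth_second_form i j : smooth_on U (h i j).
Proof.
have sT k a := smooth_frame_coord k a; have sN a := smooth_normal_coord a.
have sDN a := sD i (sN a).
apply: (@smooth_on_eq _ _ _ _ (fun v => - ((D i (N 0) v + T i 0 v * N 2 v) * T j 0 v
  + (D i (N 1) v - T i 1 v * N 2 v) * T j 1 v
  + (D i (N 2) v + (T i 1 v * N 1 v - T i 0 v * N 0 v)) * T j 2 v))) => //.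
  move=> v Uv; rewrite second_form_coord // /dot3 sum3.
  by rewrite sol_gamma0 sol_gamma1 sol_gamma2.
smooth oU.
Qed.

(** The derivative of xi is tangent because xi has constant length and [sol_gamma] is skew in its
    last argument. *)
Lemma weingarten i u a : U u ->
  D i (N a) u + sol_gamma (Tv i u) (Nv u) a = - h i 0 u * T 0 a u + - h i 1 u * T 1 a u.
Proof.
move=> Uu; have o := orthonormal_coord Uu.
have NN v : U v -> dot3 (N^~ v) (N^~ v) = 1.
  by move=> Uv; have [[_ _ ->]] := orthonormal_coord Uv.
have dNN := dot3_const_derive i smooth_normal_coord smooth_normal_coord NN Uu.
have xn : dot3 (fun b => D i (N b) u + sol_gamma (Tv i u) (Nv u) b) (Nv u) = 0.
  rewrite dot3D; have := sol_gamma_skew (Tv i u) (Nv u) (Nv u).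
  by move: dNN; exact: half_sum.
rewrite !second_form_coord // !opprK.
exact: (weingarten_algebra o xn a).
Qed.

Lemma structure_equations u : U u ->
  [/\ h 0 1 u = h 1 0 u,
      forall a, D 0 (T 0 a) u = h 0 0 u * N a u + w 0 u * T 1 a u - sol_gamma (Tv 0 u) (Tv 0 u) a,
      forall a, D 0 (T 1 a) u = h 0 1 u * N a u - w 0 u * T 0 a u - sol_gamma (Tv 0 u) (Tv 1 u) a,
      forall a, D 1 (T 0 a) u = h 0 1 u * N a u + w 1 u * T 1 a u - sol_gamma (Tv 1 u) (Tv 0 u) a &
      forall a, D 1 (T 1 a) u = h 1 1 u * N a u - w 1 u * T 0 a u - sol_gamma (Tv 1 u) (Tv 1 u) a].
Proof.
move=> Uu; have o v := @orthonormal_coord v.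
have sT i a := smooth_frame_coord i a; have sN := smooth_normal_coord.
have o00 v : U v -> dot3 (T 0 ^~ v) (T 0 ^~ v) = 1 by move=> /o [[]].
have o11 v : U v -> dot3 (T 1 ^~ v) (T 1 ^~ v) = 1 by move=> /o [[]].
have o01 v : U v -> dot3 (T 0 ^~ v) (T 1 ^~ v) = 0 by move=> /o [_ []].
have o0n v : U v -> dot3 (T 0 ^~ v) (N ^~ v) = 0 by move=> /o [_ []].
have o1n v : U v -> dot3 (T 1 ^~ v) (N ^~ v) = 0 by move=> /o [_ []].
exact: (gauss_formula_algebra (o u Uu)
  (dot3_const_derive 0 (sT 0) (sT 0) o00 Uu) (dot3_const_derive 0 (sT 0) (sT 1) o01 Uu)
  (dot3_const_derive 0 (sT 1) (sT 1) o11 Uu) (dot3_const_derive 1 (sT 0) (sT 0) o00 Uu)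
  (dot3_const_derive 1 (sT 0) (sT 1) o01 Uu) (dot3_const_derive 1 (sT 1) (sT 1) o11 Uu)
  (dot3_const_derive 0 (sT 0) sN o0n Uu) (dot3_const_derive 0 (sT 1) sN o1n Uu)
  (dot3_const_derive 1 (sT 0) sN o0n Uu) (dot3_const_derive 1 (sT 1) sN o1n Uu)
  (fun a => weingarten 0 a Uu) (fun a => weingarten 1 a Uu)
  (fun a => frame_coord_torsion a Uu)).
Qed.

(** * The Codazzi equation and the second derivatives of A *)

Let sT i a := smooth_frame_coord i a.
Let sN := smooth_normal_coord.
Let sh i j := smooth_second_form i j.

Lemma second_form_sym v : U v -> h 1 0 v = h 0 1 v.
Proof. by move=> /structure_equations[]. Qed.

Lemma derive_normal0 a v : U v -> D 0 (N a) v =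
  - (h 0 0 v * T 0 a v) - h 0 1 v * T 1 a v - sol_gamma (Tv 0 v) (Nv v) a.
Proof. by move=> Uv; rewrite -!mulNr -(weingarten 0 a Uv) addrK. Qed.

Lemma derive_normal1 a v : U v -> D 1 (N a) v =
  - (h 0 1 v * T 0 a v) - h 1 1 v * T 1 a v - sol_gamma (Tv 1 v) (Nv v) a.
Proof.
by move=> Uv; rewrite -!mulNr -(second_form_sym Uv) -(weingarten 1 a Uv) addrK.
Qed.

Let derive2_normal (k l : 'rV[R]_2 -> R) i j a u : U u ->
  smooth_on U k -> smooth_on U l ->
  (forall v, U v -> D i (N a) v =
    - (k v * T 0 a v) - l v * T 1 a v - sol_gamma (Tv i v) (Nv v) a) ->
  D j (D i (N a)) u = - (k u * D j (T 0 a) u + D j k u * T 0 a u)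
    - (l u * D j (T 1 a) u + D j l u * T 1 a u)
    - (sol_gamma (Tv i u) (fun b => D j (N b) u) a
       + sol_gamma (fun b => D j (T i b) u) (Nv u) a).
Proof.
move=> Uu sk sl dN; rewrite {1}/frame_derive (open_derive_eq _ oU Uu dN).
apply: derive_val; apply: is_derive_add; first derive_rules oU Uu.
apply: is_derive_opp; apply: is_derive_gamma => b.
  exact: smooth_is_derive (sT i b) Uu.
exact: smooth_is_derive (sN b) Uu.
Qed.

(* The components of nabla A in the frame. *)
Let c00 k v : R := D k (h 0 0) v - 2 * w k v * h 0 1 v.
Let c01 k v : R := D k (h 0 1) v - w k v * h 1 1 v + w k v * h 0 0 v.
Let c11 k v : R := D k (h 1 1) v + 2 * w k v * h 0 1 v.

Lemma codazzi u : U u ->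
  c01 0 u - c00 1 u = 2 * N 2 u * T 1 2 u /\ c11 0 u - c01 1 u = - (2 * N 2 u * T 0 2 u).
Proof.
move=> Uu; have [_ E00 E01 E10 E11] := structure_equations Uu.
have W0 a : D 0 (N a) u = - h 0 0 u * T 0 a u + - h 0 1 u * T 1 a u
    - sol_gamma (Tv 0 u) (Nv u) a by rewrite derive_normal0 // !mulNr.
have W1 a : D 1 (N a) u = - h 0 1 u * T 0 a u + - h 1 1 u * T 1 a u
    - sol_gamma (Tv 1 u) (Nv u) a by rewrite derive_normal1 // !mulNr.
apply: (codazzi_algebra (orthonormal_coord Uu) W0 W1 E00 E01 E10 E11) => a.
have := frame_commute oU sg gsym hF (sN a) Uu.
rewrite (derive2_normal 0 Uu (sh 0 1) (sh 1 1) (derive_normal1 a)).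
by rewrite (derive2_normal 1 Uu (sh 0 0) (sh 0 1) (derive_normal0 a)).
Qed.

Let sc00 k : smooth_on U (c00 k).
Proof. by have := sD k (sh 0 0); rewrite /c00 => ?; smooth oU. Qed.
Let sc01 k : smooth_on U (c01 k).
Proof. by have := sD k (sh 0 1); rewrite /c01 => ?; smooth oU. Qed.
Let sc11 k : smooth_on U (c11 k).
Proof. by have := sD k (sh 1 1); rewrite /c11 => ?; smooth oU. Qed.

Let codazzi0 v : U v -> c01 0 v = c00 1 v + 2 * N 2 v * T 1 2 v.
Proof. by move=> /codazzi[<- _]; rewrite addrC subrK. Qed.

Let codazzi1 v : U v -> c01 1 v = c11 0 v + 2 * N 2 v * T 0 2 v.
Proof. by move=> /codazzi[_ /(canRL (subrK _)) ->]; rewrite addrAC addNr add0r. Qed.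

Let derive_h00 k v : U v -> D k (h 0 0) v = c00 k v + 2 * w k v * h 0 1 v.
Proof. by move=> _; rewrite /c00 subrK. Qed.

Let derive_h11 k v : U v -> D k (h 1 1) v = c11 k v - 2 * w k v * h 0 1 v.
Proof. by move=> _; rewrite /c11 addrK. Qed.

Let derive_h01 k v : U v -> D k (h 0 1) v = c01 k v + w k v * (h 1 1 v - h 0 0 v).
Proof. by move=> _; rewrite /c01 mulrBr addrA addrAC addrK subrK. Qed.

Let derive_on (k l : 'rV[R]_2 -> R) i (r : R) u : U u -> (forall v, U v -> k v = l v) ->
  is_derive u (F i u) l r -> D i k u = r.
Proof.
move=> Uu kl dl; rewrite /frame_derive (open_derive_eq _ oU Uu kl).
exact: derive_val.
Qed.

Let dcod0 i u : U u -> D i (c01 0) u =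
  D i (c00 1) u + (2 * N 2 u * D i (T 1 2) u + 2 * D i (N 2) u * T 1 2 u).
Proof. by move=> Uu; apply: (derive_on Uu codazzi0); derive_rules oU Uu. Qed.

Let dcod1 i u : U u -> D i (c01 1) u =
  D i (c11 0) u + (2 * N 2 u * D i (T 0 2) u + 2 * D i (N 2) u * T 0 2 u).
Proof. by move=> Uu; apply: (derive_on Uu codazzi1); derive_rules oU Uu. Qed.

Let dd00 i j u : U u -> D i (D j (h 0 0)) u =
  D i (c00 j) u + (2 * w j u * D i (h 0 1) u + 2 * D i (w j) u * h 0 1 u).
Proof. by move=> Uu; apply: (derive_on Uu (@derive_h00 j)); derive_rules oU Uu. Qed.

Let dd11 i j u : U u -> D i (D j (h 1 1)) u =
  D i (c11 j) u - (2 * w j u * D i (h 0 1) u + 2 * D i (w j) u * h 0 1 u).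
Proof. by move=> Uu; apply: (derive_on Uu (@derive_h11 j)); derive_rules oU Uu. Qed.

Let dd01 i j u : U u -> D i (D j (h 0 1)) u = D i (c01 j) u +
  (w j u * (D i (h 1 1) u - D i (h 0 0) u) + D i (w j) u * (h 1 1 u - h 0 0 u)).
Proof. by move=> Uu; apply: (derive_on Uu (@derive_h01 j)); derive_rules oU Uu. Qed.

Let subst_comm (x x' y y' p q : R) : x = x' -> y = y' -> x = y - p - q -> x' = y' - p - q.
Proof. by move=> -> ->. Qed.

Let com00 u : U u -> D 0 (c00 1) u + (2 * w 1 u * D 0 (h 0 1) u + 2 * D 0 (w 1) u * h 0 1 u) =
  D 1 (c00 0) u + (2 * w 0 u * D 1 (h 0 1) u + 2 * D 1 (w 0) u * h 0 1 u)
  - w 0 u * D 0 (h 0 0) u - w 1 u * D 1 (h 0 0) u.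
Proof.
move=> Uu; exact: (subst_comm (dd00 0 1 Uu) (dd00 1 0 Uu)
  (frame_commute oU sg gsym hF (sh 0 0) Uu)).
Qed.

Let com11 u : U u -> D 0 (c11 1) u - (2 * w 1 u * D 0 (h 0 1) u + 2 * D 0 (w 1) u * h 0 1 u) =
  D 1 (c11 0) u - (2 * w 0 u * D 1 (h 0 1) u + 2 * D 1 (w 0) u * h 0 1 u)
  - w 0 u * D 0 (h 1 1) u - w 1 u * D 1 (h 1 1) u.
Proof.
move=> Uu; exact: (subst_comm (dd11 0 1 Uu) (dd11 1 0 Uu)
  (frame_commute oU sg gsym hF (sh 1 1) Uu)).
Qed.

Let com01 u : U u -> D 0 (c01 1) u +
    (w 1 u * (D 0 (h 1 1) u - D 0 (h 0 0) u) + D 0 (w 1) u * (h 1 1 u - h 0 0 u)) =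
  D 1 (c01 0) u +
    (w 0 u * (D 1 (h 1 1) u - D 1 (h 0 0) u) + D 1 (w 0) u * (h 1 1 u - h 0 0 u))
  - w 0 u * D 0 (h 0 1) u - w 1 u * D 1 (h 0 1) u.
Proof.
move=> Uu; exact: (subst_comm (dd01 0 1 Uu) (dd01 1 0 Uu)
  (frame_commute oU sg gsym hF (sh 0 1) Uu)).
Qed.

(** * The terms of the formula in the frame *)

Lemma shape_frame0 v : U v -> F 0 v *m A v = h 0 0 v *: F 0 v + h 0 1 v *: F 1 v.
Proof. by move=> Uv; rewrite {1}(frame_expand hF (F 0 v *m A v) Uv). Qed.

Lemma shape_frame1 v : U v -> F 1 v *m A v = h 0 1 v *: F 0 v + h 1 1 v *: F 1 v.
Proof.
by move=> Uv; rewrite {1}(frame_expand hF (F 1 v *m A v) Uv) -(second_form_sym Uv).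
Qed.

Lemma shape_frame_vec (a b : R) v : U v -> (a *: F 0 v + b *: F 1 v) *m A v =
  (a * h 0 0 v + b * h 0 1 v) *: F 0 v + (a * h 0 1 v + b * h 1 1 v) *: F 1 v.
Proof.
move=> Uv; rewrite mulmxDl -!scalemxAl shape_frame0 // shape_frame1 //.
by rewrite !scalerDr !scalerA !scalerDl addrACA.
Qed.

Lemma mean_curvature_frame v : U v -> mean_curvature A v = 2^-1 * (h 0 0 v + h 1 1 v).
Proof. by move=> Uv; rewrite /mean_curvature (frame_trace hF _ Uv). Qed.

Lemma shape_sqnorm_frame v : U v ->
  shape_sqnorm A v = h 0 0 v * h 0 0 v + 2 * (h 0 1 v * h 0 1 v) + h 1 1 v * h 1 1 v.
Proof.
move=> Uv; rewrite /shape_sqnorm (frame_trace hF _ Uv) !mulmxA.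
rewrite shape_frame0 // shape_frame1 // !shape_frame_vec //.
rewrite (inner_frame0 hF) // (inner_frame1 hF) //.
by move: (h 0 0 v) (h 0 1 v) (h 1 1 v) => x y z; ring.
Qed.

(** [H2] and [Hm] agree with [shape_sqnorm] and [mean_curvature] on U and are polynomial in smooth
    functions; [laplacian_eq] and [grad_eq] make the exchange. *)
Let H2 v := h 0 0 v * h 0 0 v + 2 * (h 0 1 v * h 0 1 v) + h 1 1 v * h 1 1 v.
Let Hm v := 2^-1 * (h 0 0 v + h 1 1 v).

Let sH2 : smooth_on U H2. Proof. rewrite /H2; smooth oU. Qed.
Let sHm : smooth_on U Hm. Proof. rewrite /Hm; smooth oU. Qed.

Let derive_H2 k v : U v -> D k H2 v =
  2 * (h 0 0 v * c00 k v + 2 * (h 0 1 v * c01 k v) + h 1 1 v * c11 k v).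
Proof.
move=> Uv; have -> : D k H2 v = h 0 0 v * D k (h 0 0) v + D k (h 0 0) v * h 0 0 v
   + 2 * (h 0 1 v * D k (h 0 1) v + D k (h 0 1) v * h 0 1 v)
   + (h 1 1 v * D k (h 1 1) v + D k (h 1 1) v * h 1 1 v).
  by apply: derive_val; rewrite /H2; derive_rules oU Uv.
rewrite derive_h00 // derive_h01 // derive_h11 //.
move: (h 0 0 v) (h 0 1 v) (h 1 1 v) (c00 k v) (c01 k v) (c11 k v) (w k v).
by move=> *; ring.
Qed.

Let derive_Hm k v : U v -> D k Hm v = 2^-1 * (c00 k v + c11 k v).
Proof.
move=> Uv; have -> : D k Hm v = 2^-1 * (D k (h 0 0) v + D k (h 1 1) v).
  by apply: derive_val; rewrite /Hm; derive_rules oU Uv.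
rewrite derive_h00 // derive_h11 //.
move: (h 0 1 v) (c00 k v) (c11 k v) (w k v).
by move=> *; ring.
Qed.

Let laplacian_sqnorm u : U u -> laplacian g (shape_sqnorm A) u =
  2 * (h 0 0 u * D 0 (c00 0) u + D 0 (h 0 0) u * c00 0 u
       + 2 * (h 0 1 u * D 0 (c01 0) u + D 0 (h 0 1) u * c01 0 u)
       + (h 1 1 u * D 0 (c11 0) u + D 0 (h 1 1) u * c11 0 u))
  + 2 * (h 0 0 u * D 1 (c00 1) u + D 1 (h 0 0) u * c00 1 u
       + 2 * (h 0 1 u * D 1 (c01 1) u + D 1 (h 0 1) u * c01 1 u)
       + (h 1 1 u * D 1 (c11 1) u + D 1 (h 1 1) u * c11 1 u))
  + 2 * (h 0 0 u * c00 0 u + 2 * (h 0 1 u * c01 0 u) + h 1 1 u * c11 0 u) * w 1 u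
  - 2 * (h 0 0 u * c00 1 u + 2 * (h 0 1 u * c01 1 u) + h 1 1 u * c11 1 u) * w 0 u.
Proof.
move=> Uu; rewrite (laplacian_eq g oU Uu shape_sqnorm_frame).
rewrite (laplacian_frame oU sg gsym hF sH2 Uu) (derive_H2 0 Uu) (derive_H2 1 Uu).
congr (_ + _ + _ - _); apply: (derive_on Uu (@derive_H2 _)); derive_rules oU Uu.
Qed.

Let grad_mean v : U v -> grad g (mean_curvature A) v =
  2^-1 * (c00 0 v + c11 0 v) *: F 0 v + 2^-1 * (c00 1 v + c11 1 v) *: F 1 v.
Proof.
move=> Uv; rewrite (grad_eq g oU Uv mean_curvature_frame).
by rewrite (grad_frame hF sHm Uv) /frame_vec (derive_Hm 0 Uv) (derive_Hm 1 Uv).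
Qed.

Let f0 v := 2^-1 * (c00 0 v + c11 0 v).
Let f1 v := 2^-1 * (c00 1 v + c11 1 v).

Let divergence_shape_grad u : U u ->
  divergence g (endo_app A (grad g (mean_curvature A))) u =
  f0 u * D 0 (h 0 0) u + 2^-1 * (D 0 (c00 0) u + D 0 (c11 0) u) * h 0 0 u
  + (f1 u * D 0 (h 0 1) u + 2^-1 * (D 0 (c00 1) u + D 0 (c11 1) u) * h 0 1 u)
  + (f0 u * D 1 (h 0 1) u + 2^-1 * (D 1 (c00 0) u + D 1 (c11 0) u) * h 0 1 u
     + (f1 u * D 1 (h 1 1) u + 2^-1 * (D 1 (c00 1) u + D 1 (c11 1) u) * h 1 1 u))
  + (f0 u * h 0 0 u + f1 u * h 0 1 u) * w 1 u - (f0 u * h 0 1 u + f1 u * h 1 1 u) * w 0 u.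
Proof.
move=> Uu.
pose a v := 2^-1 * (c00 0 v + c11 0 v) * h 0 0 v + 2^-1 * (c00 1 v + c11 1 v) * h 0 1 v.
pose b v := 2^-1 * (c00 0 v + c11 0 v) * h 0 1 v + 2^-1 * (c00 1 v + c11 1 v) * h 1 1 v.
have E v : U v -> endo_app A (grad g (mean_curvature A)) v = frame_vec F a b v.
  by move=> Uv; rewrite /endo_app grad_mean // shape_frame_vec.
have sa : smooth_on U a by rewrite /a; smooth oU.
have sb : smooth_on U b by rewrite /b; smooth oU.
rewrite (divergence_eq g oU Uu E) (divergence_frame_vec oU sg gsym hF sa sb Uu).
by congr (_ + _ + _ - _); apply: derive_val; rewrite /a /b; derive_rules oU Uu.
Qed.

Let nabla_shape0 i u : U u ->
  nabla_endo g A (F i) (F 0) u = c00 i u *: F 0 u + c01 i u *: F 1 u.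
Proof.
move=> Uu; rewrite /nabla_endo.
rewrite (nabla_eq g oU (F i) Uu (Z := frame_vec F (h 0 0) (h 0 1))); last first.
  by move=> v Uv; exact: shape_frame0.
rewrite [X in X - _](nabla_frame_vec oU sg gsym hF (F i u) (sh 0 0) (sh 0 1) Uu).
rewrite /endo_app (nabla_frame0 oU sg gsym hF) // -scalemxAl shape_frame1 //.
rewrite (frame_form_dir hF) // scalerDr !scalerA opprD addrACA -!scalerBl /c00 /c01 /frame_derive.
have e0 (d x y : R) : d - x * y - x * y = d - 2 * x * y by ring.
have e1 (d x y z : R) : d + x * y - x * z = d - x * z + x * y by ring.
by congr (_ *: _ + _ *: _); [exact: e0|exact: e1].
Qed.

Let nabla_shape1 i u : U u ->
  nabla_endo g A (F i) (F 1) u = c01 i u *: F 0 u + c11 i u *: F 1 u.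
Proof.
move=> Uu; rewrite /nabla_endo.
rewrite (nabla_eq g oU (F i) Uu (Z := frame_vec F (h 0 1) (h 1 1))); last first.
  by move=> v Uv; exact: shape_frame1.
rewrite [X in X - _](nabla_frame_vec oU sg gsym hF (F i u) (sh 0 1) (sh 1 1) Uu).
rewrite /endo_app (nabla_frame1 oU sg gsym hF) // -scalemxAl shape_frame0 //.
rewrite (frame_form_dir hF) // scalerDr !scalerA opprD addrACA -!scalerBl /c11 /c01 /frame_derive.
have e0 (d x y z : R) : d - x * z - - x * y = d - x * z + x * y by ring.
have e1 (d x y : R) : d + x * y - - x * y = d + 2 * x * y by ring.
by congr (_ *: _ + _ *: _); [exact: e0|exact: e1].
Qed.

Let dot_delta (x y : 'I_3 -> R) b : (forall a, x a = (a == b)%:R) -> \sum_a x a * y a = y b.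
Proof.
move=> xb; rewrite (bigD1 b) //= xb eqxx mul1r big1 ?addr0 // => a ab.
by rewrite xb (negbTE ab) mul0r.
Qed.

(** The hypothesis says that V is the frame vector of index b counted from 0: E1, E2, E3 for b = 0,
    1, 2. *)
Let tangent_frame V b u : U u -> (forall a, sol_coord (psi u) V a = (a == b)%:R) ->
  tangent_part g psi V u = T 0 b u *: F 0 u + T 1 b u *: F 1 u.
Proof.
move=> Uu Vb; rewrite [LHS](frame_expand hF _ Uu) !inner_tangent_part // !inner_sol.
by rewrite !(dot_delta _ Vb).
Qed.

Let normal_frame V b u : U u -> (forall a, sol_coord (psi u) V a = (a == b)%:R) ->
  inner (sol_metric (psi u)) (nu u) (normal_part g psi V u) = N b u.
Proof.
move=> Uu Vb; rewrite inner_normal_part // inner_sol -(dot_delta (Nv u) Vb).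
by apply: eq_bigr => a _; rewrite mulrC.
Qed.

Lemma simons_formula u : U u ->
  let f := mean_curvature A in
  let K := gauss_curvature g u in
  let A2 := shape_sqnorm A in
  let Ip := inner (g u) in
  let xiE (E : 'rV[R]_3 -> 'rV[R]_3) :=
    inner (sol_metric (psi u)) (nu u) (normal_part g psi (E (psi u)) u) in
  let ET (E : 'rV[R]_3 -> 'rV[R]_3) := tangent_part g psi (E (psi u)) u in
  let AE (E : 'rV[R]_3 -> 'rV[R]_3) := ET E *m A u in
  2^-1 * laplacian g A2 u
  = nabla_endo_sqnorm g A F u
    + 2 * divergence g (endo_app A (grad g f)) u
    - 4 * Ip (grad g f u) (grad g f u)
    - 4 * xiE E3 * Ip (grad g f u) (ET E3)
    + 2 * K * (A2 u - 2 * f u ^+ 2)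
    + 4 * xiE E3 ^+ 2 * (A2 u - 2 * f u ^+ 2)
    - 8 * f u * xiE E3 * (xiE E2 ^+ 2 - xiE E1 ^+ 2)
    + 4 * f u * Ip (AE E3) (ET E3)
    + 4 * xiE E3 * Ip (AE E1) (ET E1)
    - 4 * xiE E3 * Ip (AE E2) (ET E2)
    + 4 * xiE E1 * Ip (AE E3) (ET E1)
    - 4 * xiE E2 * Ip (AE E3) (ET E2)
    - 4 * Ip (AE E3) (AE E3).
Proof.
move=> Uu f K A2 Ip xiE ET AE.
have x1 : xiE E1 = N 0 u by apply: normal_frame => // a; exact: sol_coord_E1.
have x2 : xiE E2 = N 1 u by apply: normal_frame => // a; exact: sol_coord_E2.
have x3 : xiE E3 = N 2 u by apply: normal_frame => // a; exact: sol_coord_E3.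
have t1 : ET E1 = T 0 0 u *: F 0 u + T 1 0 u *: F 1 u.
  by apply: tangent_frame => // a; exact: sol_coord_E1.
have t2 : ET E2 = T 0 1 u *: F 0 u + T 1 1 u *: F 1 u.
  by apply: tangent_frame => // a; exact: sol_coord_E2.
have t3 : ET E3 = T 0 2 u *: F 0 u + T 1 2 u *: F 1 u.
  by apply: tangent_frame => // a; exact: sol_coord_E3.
have a1 : AE E1 = _ := etrans (congr1 (mulmx^~ (A u)) t1) (shape_frame_vec _ _ Uu).
have a2 : AE E2 = _ := etrans (congr1 (mulmx^~ (A u)) t2) (shape_frame_vec _ _ Uu).
have a3 : AE E3 = _ := etrans (congr1 (mulmx^~ (A u)) t3) (shape_frame_vec _ _ Uu).
have gf : grad g f u = f0 u *: F 0 u + f1 u *: F 1 u by exact: grad_mean.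
have IpE (a b c d : R) : Ip (a *: F 0 u + b *: F 1 u) (c *: F 0 u + d *: F 1 u) = a * c + b * d.
  exact: (inner_frame hF).
have nA : nabla_endo_sqnorm g A F u = c00 0 u * c00 0 u + c01 0 u * c01 0 u
    + (c01 0 u * c01 0 u + c11 0 u * c11 0 u)
    + (c00 1 u * c00 1 u + c01 1 u * c01 1 u + (c01 1 u * c01 1 u + c11 1 u * c11 1 u)).
  rewrite /nabla_endo_sqnorm !sum2 !nabla_shape0 // !nabla_shape1 //.
  by rewrite !(inner_frame hF).
rewrite x1 x2 x3 a1 a2 a3 t1 t2 t3 gf !IpE nA.
rewrite [A2 u](shape_sqnorm_frame Uu) [f u](mean_curvature_frame Uu).
rewrite (laplacian_sqnorm Uu) (divergence_shape_grad Uu).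
have [_ S00 S01 S10 S11] := structure_equations Uu.
have W0 := weingarten 0 2 Uu; have W1 := weingarten 1 2 Uu.
have o := orthonormal_coord Uu.
have col00 : T 0 0 u * T 0 0 u + T 1 0 u * T 1 0 u + N 0 u * N 0 u = 1.
  exact: (orthonormal3_columns 0 0 o).
have col11 : T 0 1 u * T 0 1 u + T 1 1 u * T 1 1 u + N 1 u * N 1 u = 1.
  exact: (orthonormal3_columns 1 1 o).
have col02 : T 0 0 u * T 0 2 u + T 1 0 u * T 1 2 u + N 0 u * N 2 u = 0.
  exact: (orthonormal3_columns 0 2 o).
have col12 : T 0 1 u * T 0 2 u + T 1 1 u * T 1 2 u + N 1 u * N 2 u = 0.
  exact: (orthonormal3_columns 1 2 o).
have dm0 : D 0 (N 2) u = - h 0 0 u * T 0 2 u + - h 0 1 u * T 1 2 u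
    - (T 0 1 u * N 1 u - T 0 0 u * N 0 u).
  by rewrite -W0 sol_gamma2 addrK.
have dm1 : D 1 (N 2) u = - h 0 1 u * T 0 2 u + - h 1 1 u * T 1 2 u
    - (T 1 1 u * N 1 u - T 1 0 u * N 0 u).
  by rewrite -(second_form_sym Uu) -W1 sol_gamma2 addrK.
have dp0 := S00 2; have dq0 := S01 2; have dp1 := S10 2; have dq1 := S11 2.
rewrite !sol_gamma2 in dp0 dq0 dp1 dq1.
(* The two explicit arguments are [e0000] and [e1111], which occur only in the conclusion and cannot
   be inferred from the hypotheses. *)
exact: (simons_algebra (D 0 (c00 0) u) (D 1 (c11 1) u) col00 col11 col02 col12 dm0 dm1 dp0 dq0 dp1 dq1
  (derive_h00 0 Uu) (derive_h00 1 Uu) (derive_h01 0 Uu) (derive_h01 1 Uu)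
  (derive_h11 0 Uu) (derive_h11 1 Uu) (codazzi0 Uu) (codazzi1 Uu)
  (dcod0 0 Uu) (dcod0 1 Uu) (dcod1 0 Uu) (dcod1 1 Uu)
  (com00 Uu) (com11 Uu) (com01 Uu) (gauss_curvature_frame oU sg gsym hF Uu)).
Qed.

End surface.

Theorem theorem3p1 (R : realType) (S : riemannian_surface R)
  (phi xi : S -> 'rV[R]_3)
  (hphi : isometric_immersion phi)
  (hxi : unit_normal_field phi xi)
  (c : @chart R S) (hc : atlas c)
  (U : set 'rV[R]_2) (hU : open U) (hUc : U `<=` chart_cod c)
  (F : 'I_2 -> 'rV[R]_2 -> 'rV[R]_2)
  (hF : orthonormal_frame_on (metric c) U F)
  (p : S) (hp : chart_dom c p) (hpU : U (chart_coord c p)) :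
  let u := chart_coord c p in
  let psi := phi \o chart_param c in
  let nu := xi \o chart_param c in
  let g := metric c in
  let A := shape_operator g psi nu in
  let f := mean_curvature A in
  let K := gauss_curvature g u in
  let A2 := shape_sqnorm A in
  let Ip := inner (g u) in
  let xiE (E : 'rV[R]_3 -> 'rV[R]_3) :=
    inner (sol_metric (psi u)) (nu u) (normal_part g psi (E (psi u)) u) in
  let ET (E : 'rV[R]_3 -> 'rV[R]_3) := tangent_part g psi (E (psi u)) u in
  let AE (E : 'rV[R]_3 -> 'rV[R]_3) := ET E *m A u in
  2^-1 * laplacian g A2 u
  = nabla_endo_sqnorm g A F u
    + 2 * divergence g (endo_app A (grad g f)) u
    - 4 * Ip (grad g f u) (grad g f u)
    - 4 * xiE E3 * Ip (grad g f u) (ET E3)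
    + 2 * K * (A2 u - 2 * f u ^+ 2)
    + 4 * xiE E3 ^+ 2 * (A2 u - 2 * f u ^+ 2)
    - 8 * f u * xiE E3 * (xiE E2 ^+ 2 - xiE E1 ^+ 2)
    + 4 * f u * Ip (AE E3) (ET E3)
    + 4 * xiE E3 * Ip (AE E1) (ET E1)
    - 4 * xiE E3 * Ip (AE E2) (ET E2)
    + 4 * xiE E1 * Ip (AE E3) (ET E1)
    - 4 * xiE E2 * Ip (AE E3) (ET E2)
    - 4 * Ip (AE E3) (AE E3).
Proof.
have [spsi himm] := hphi c hc; have [snu hnu] := hxi c hc.
(* U lies in the image of the chart, so the hypotheses are restrictions to U of the data of the
   surface. *)
apply: simons_formula hpU => //.
- exact: smooth_on_sub hUc (metric_smooth hc).
- by move=> v /hUc; exact: metric_sym.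
- exact: smooth_on_sub hUc spsi.
- exact: smooth_on_sub hUc snu.
- by move=> v /hUc /himm[].
- by move=> v /hUc /hnu[].
- by move=> v /hUc /hnu[].
Qed.
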